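(* Let $n\ge1$ and let $\varphi:\mathbb{R}^+\to\mathbb{R}^+\cup\{0\}$ be a $\mathscr{C}^1$ function with $\int_0^\infty\rho^{n-1}\varphi(\rho)\,d\rho<\infty$ and $|\varphi'(\rho)|\le\frac{B}{\rho^{n+1}}$ for some constant $B$ and every $\rho>0$. Let $(\varepsilon_j)_{j\in\mathbb{Z}^+}$ be a sequence of positive random variables on a probability space $(\Omega,\mathscr{F},\mathscr{P})$, with $\varepsilon_j$ distributed according to $\nu_j$, and let $y_j\equiv\mathbf{0}$ for every $j$. Assume that $\{\nu_j:j\in\mathbb{Z}^+\}$ is self-similar, i.e. $\nu_j(B')=\nu_1(jB')$ for every $j\in\mathbb{Z}^+$ and every Borel set $B'\subseteq\mathbb{R}$. Then the maximal operator $$\mathscr{M}f(x)=\sup_{j\ge1}m_j(|f|)(x)$$ is of weak type $(1,1)$.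
   Context: $\mathbb{R}^+=\{t\in\mathbb{R}:t>0\}$, $\mathbb{Z}^+=\{1,2,3,\dots\}$, and $jB'=\{jt:t\in B'\}$. $\mathscr{E}$ denotes expectation. With $y_j\equiv\mathbf{0}$, for nonnegative measurable $f$ on $\mathbb{R}^n$, $$m_j(f)(x)=\mathscr{E}\left[\frac{1}{\varepsilon_j^n(\omega)}\int_{z\in\mathbb{R}^n}\varphi\left(\frac{|x-z|}{\varepsilon_j(\omega)}\right)f(z)\,dz\right]\in[0,\infty].$$ $\mathscr{M}$ is of weak type $(1,1)$ if there is a constant $A>0$ such that $|\{x\in\mathbb{R}^n:\mathscr{M}f(x)>\lambda\}|\le\frac{A}{\lambda}\|f\|_{L^1(\mathbb{R}^n)}$ for every $\lambda>0$ and every $f\in L^1(\mathbb{R}^n)$, where $|\cdot|$ of a set is Lebesgue measure. *)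

(* Defs.v *)
From HB Require Import structures.
From mathcomp Require Import all_boot all_order all_algebra.
From mathcomp Require Import all_classical all_reals all_analysis.

Set Implicit Arguments.
Unset Strict Implicit.
Unset Printing Implicit Defensive.

Import Order.TTheory GRing.Theory Num.Theory.
Import numFieldNormedType.Exports.

Local Open Scope classical_set_scope.
Local Open Scope ring_scope.

Section cons_measure.
Local Open Scope ereal_scope.
Context {R : realType} (n : nat).
Let T := measurableTypeR R.
Variable mu : {sigma_finite_measure set (n.-tuple T) -> \bar R}.

Definition tuple_of_pair (p : T * n.-tuple T) : n.+1.-tuple T :=
  [tuple of p.1 :: p.2].

Lemma measurable_tuple_of_pair : measurable_fun [set: _] tuple_of_pair.
Proof. exact: measurable_cons. Qed.

(* the product of one-dimensional Lebesgue measure and [mu], carried over from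
   pairs to (n+1)-tuples *)
Definition cons_measure : set (n.+1.-tuple T) -> \bar R :=
  pushforward (lebesgue_measure \x mu) tuple_of_pair.

Let measurable_preimage A : measurable A -> measurable (tuple_of_pair @^-1` A).
Proof. by move=> mA; rewrite -[X in measurable X]setTI; exact: measurable_tuple_of_pair. Qed.

Let cons_measure0 : cons_measure set0 = 0.
Proof. by rewrite /cons_measure /pushforward preimage_set0 measure0. Qed.

Let cons_measure_ge0 A : 0 <= cons_measure A.
Proof. by rewrite /cons_measure /pushforward measure_ge0. Qed.

Let cons_measure_semi_sigma_additive : semi_sigma_additive cons_measure.
Proof.
move=> F mF tF mUF; rewrite /cons_measure /pushforward preimage_bigcup.
apply: measure_semi_sigma_additive.
- by move=> k; exact: measurable_preimage.
- apply/trivIsetP => /= i j _ _ ij; rewrite -preimage_setI.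
  by move/trivIsetP : tF => /(_ _ _ _ _ ij) ->//; rewrite preimage_set0.
- by rewrite -preimage_bigcup; exact: measurable_preimage.
Qed.

HB.instance Definition _ := isMeasure.Build _ _ _ cons_measure
  cons_measure0 cons_measure_ge0 cons_measure_semi_sigma_additive.

Let cons_measure_sigma_finite : sigma_finite [set: _] cons_measure.
Proof.
have /sigma_finiteP[F [UF ndF mF]] := @sigma_finiteT _ _ _ (@lebesgue_measure R).
have /sigma_finiteP[G [UG ndG mG]] := sigma_finiteT mu.
pose g (x : n.+1.-tuple T) : T * n.-tuple T := (thead x, [tuple of behead x]).
have mg : measurable_fun [set: _] g.
  apply/measurable_fun_pairP; split.
    exact: measurable_tnth.
  exact: measurable_behead.
have gK : g \o tuple_of_pair = id.
  by apply/funext => -[a b]; congr pair; exact/val_inj.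
exists (fun k => g @^-1` (F k `*` G k)).
  apply/esym; rewrite -subTset => x _.
  have [k _ Fk] : (\bigcup_k F k) (g x).1 by rewrite -UF.
  have [l _ Gl] : (\bigcup_k G k) (g x).2 by rewrite -UG.
  exists (maxn k l) => //; split.
    by move: Fk; exact/subsetPset/ndF/leq_maxl.
  by move: Gl; exact/subsetPset/ndG/leq_maxr.
move=> k; have [mFk Fk_fin] := mF k; have [mGk Gk_fin] := mG k; split.
  by rewrite -[X in measurable X]setTI; apply: mg => //; exact: measurableX.
rewrite /cons_measure /pushforward.
have -> : tuple_of_pair @^-1` (g @^-1` (F k `*` G k)) = F k `*` G k.
  by rewrite -comp_preimage gK preimage_id.
by rewrite product_measure1E// lte_mul_pinfty// ge0_fin_numE.
Qed.

HB.instance Definition _ := Measure_isSigmaFinite.Build _ _ _ cons_measure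
  cons_measure_sigma_finite.

End cons_measure.

Fixpoint borel_lebesgue (R : realType) (n : nat) :
    {sigma_finite_measure set (n.-tuple (measurableTypeR R)) -> \bar R} :=
  match n with
  | 0 => dirac [tuple]
  | n'.+1 => cons_measure (borel_lebesgue R n')
  end.

(* R^n with the sigma-algebra of Lebesgue measurable sets *)
Definition Rn (R : realType) (n : nat) : measurableType _ :=
  caratheodory_type ((borel_lebesgue R n)^*)%mu.

Definition lebesgue (R : realType) (n : nat) : set (Rn R n) -> \bar R :=
  @completed_measure_extension _ _ _ (borel_lebesgue R n).
HB.instance Definition _ (R : realType) (n : nat) := Measure.on (@lebesgue R n).

Definition edist (R : realType) (n : nat) (x y : Rn R n) : R :=
  Num.sqrt (\sum_(i < n) (tnth x i - tnth y i) ^+ 2).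

(* [nu j] is the law of the j-th random variable, for j >= 1; [nu 0] is unused *)
Definition self_similar (R : realType) (nu : nat -> set R -> \bar R) : Prop :=
  forall j : nat, (0 < j)%N -> forall A : set R, measurable A ->
    nu j A = nu 1%N [set j%:R * t | t in A].

Section maximal_operator.
Local Open Scope ereal_scope.
Context d (Omega : measurableType d) (R : realType) (P : probability Omega R).
Variables (n : nat) (phi : R -> R) (eps : nat -> Omega -> R).

(* [phi] matters on ]0, +oo[ only: the argument of [phi] is 0 just for z = x,
   a null set since n >= 1 *)
Definition mean_op (j : nat) (f : Rn R n -> R) (x : Rn R n) : \bar R :=
  \int[P]_w (((eps j w ^+ n)^-1)%:E *
    \int[@lebesgue R n]_z (phi (edist x z / eps j w) * f z)%:E).

Definition maximal_op (f : Rn R n -> R) (x : Rn R n) : \bar R :=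
  ereal_sup [set mean_op j (fun z => `|f z|%R) x | j in [set j | (0 < j)%N]].

End maximal_operator.

Definition weak_type_1_1 (R : realType) (n : nat)
    (M : (Rn R n -> R) -> Rn R n -> \bar R) : Prop :=
  exists2 A : R, 0 < A & forall (lambda : R) (f : Rn R n -> R),
    0 < lambda -> (@lebesgue R n).-integrable [set: _] (EFin \o f) ->
    (@lebesgue R n [set x | lambda%:E < M f x] <=
      (A / lambda)%:E * 'N[@lebesgue R n]_1[EFin \o f])%E.

(* Main.v *)
Require Import Defs.
From HB Require Import structures.
From mathcomp Require Import all_boot all_order all_algebra.
From mathcomp Require Import all_classical all_reals all_analysis.
From mathcomp Require Import measurable_realfun.
From mathcomp Require Import ring lra.
Import Order.TTheory GRing.Theory Num.Theory.
Import numFieldNormedType.Exports.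
Set Implicit Arguments.
Unset Strict Implicit.
Unset Printing Implicit Defensive.
Local Open Scope classical_set_scope.
Local Open Scope ring_scope.

(** Write phi_e for the function r |-> e^-n phi (r / e).  For each outcome w,
    the integrand of the average m_j is the convolution of phi_e(|.|) with |f|
    at e = eps_j(w).  Each m_j(|f|)(x) is an average over w of such values,
    hence at most the supremum of (phi_e(|.|) * |f|)(x) over all e > 0, and it
    suffices to bound that deterministic supremum.

    All the phi_e satisfy the same scale-invariant bounds, with one constant A
    (predicate cz_kernel, lemma cz_kernel_dilate): k r <= A / r^n, a Lipschitz
    bound |k r - k s| <= A |r - s| / r^(n+1) for r <= s, and a bound A on the
    integral of k(|y|).  There may be no integrable decreasing majorant of phi,
    so the Hardy-Littlewood maximal function does not control the supremum; the
    Lipschitz bound has to be used, as in Calderon-Zygmund theory.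

    The weak type estimate is proved first for finitely many masses a_i at
    points x_i, following an idea of Nazarov, Treil and Volberg.  Given a level
    lam, choose radii rho_i one after the other so that the part E_i of the
    ball B(x_i, rho_i) that is not yet covered has measure a_i / lam
    (eball_of_measure).  The union D of the E_i has measure sum a_i / lam and
    contains every ball.  Off D, spreading the mass a_i over E_i with density
    lam lowers its contribution by at most a constant times
    a_i rho_i / |x - x_i|^(n+1), for all kernels at once (point_mass_le); off
    the ball the integral of this error is O(a_i) (integral_tail_le).  The
    spread masses together contribute at most lam times the integral of k,
    hence at most A lam.  Markov's inequality for the sum of the errors
    finishes the argument (dirac_weak, dirac_weak_set).

    A function is compared with point masses by cutting space into small
    pieces, which is harmless if the kernels are uniformly Lipschitz
    (lipschitz_weak).  Truncating the kernels near the origin makes them so and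
    keeps them in the class (cz_kernel_truncate); the truncation is removed by
    monotone convergence, the kernels being nonnegative (cz_weak).

    The bound on the integrals of the phi_e comes from comparing the integral
    of g(|y|) over R^n with that of t^(n-1) g(t) over the half-line
    (ge0_integral_radial_le), which only uses how Lebesgue measure behaves
    under dilations. *)

(** * Affine changes of variables *)

Section change_of_variables.
Local Open Scope ereal_scope.

Lemma ge0_integral_comp_scaled {d1 d2} {X : measurableType d1}
    {Y : measurableType d2} {R : realType} (m1 : {measure set X -> \bar R})
    (m2 : {measure set Y -> \bar R}) (g : X -> Y) (c : R) (f : Y -> \bar R) :
  measurable_fun [set: X] g -> (0 <= c)%R ->
  (forall A, measurable A -> m1 (g @^-1` A) = c%:E * m2 A) ->
  measurable_fun [set: Y] f -> (forall y, 0 <= f y) ->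
  \int[m1]_x f (g x) = c%:E * \int[m2]_y f y.
Proof.
move=> mg c0 gm mf f0.
have -> : \int[m1]_x f (g x) = \int[m1]_(x in g @^-1` setT) (f \o g) x.
  by rewrite preimage_setT.
rewrite -ge0_integral_pushforward//.
pose k : {nonneg R} := NngNum c0.
transitivity (\int[mscale k m2]_y f y).
  by apply: eq_measure_integral => A mA _; exact: gm.
by rewrite ge0_integral_mscale.
Qed.

Context {R : realType}.

(** Uniqueness of Lebesgue measure is a statement about measures; this makes it
    applicable to a pushforward. *)
Lemma pushforward_is_measure {d1 d2} {X : measurableType d1}
    {Y : measurableType d2} (mu : {measure set X -> \bar R}) (g : X -> Y) :
  measurable_fun [set: X] g ->
  exists m : {measure set Y -> \bar R}, forall A, m A = mu (g @^-1` A).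
Proof. by move=> mg; unshelve (eexists [the measure _ _ of pushforward mu g]). Qed.

Lemma measurable_affine_line (c b : R) :
  measurable_fun [set: measurableTypeR R] (fun t : R => c * t + b)%R.
Proof. by apply: measurable_funD => //; apply: measurable_funM. Qed.

(** The pushforward, multiplied by c, gives every half-open interval its
    length. *)
Lemma lebesgue_measure_affine (c b : R) (A : set R) :
  (0 < c)%R -> measurable A ->
  lebesgue_measure ((fun t : R => c * t + b)%R @^-1` A) =
  (c^-1)%:E * lebesgue_measure A.
Proof.
move=> c0 mA.
have [m mE] := @pushforward_is_measure _ _ (measurableTypeR R)
  (measurableTypeR R) lebesgue_measure _ (measurable_affine_line c b).
have c0' : (0 <= c)%R by exact: ltW.
pose k : {nonneg R} := NngNum c0'.
suff -> : lebesgue_measure A = mscale k m A.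
  by rewrite /mscale mE/= muleA -EFinM mulVf ?gt_eqF// mul1e.
apply: lebesgue_measure_unique => // _ [[x y] _ <-].
pose I : set R := [set` Interval (BRight x) (BRight y)].
rewrite -[RHS]/(c%:E * m I) mE.
have -> : (fun t : R => (c * t + b)%R) @^-1` I =
    [set` Interval (BRight ((x - b) / c)%R) (BRight ((y - b) / c)%R)].
  apply/seteqP; split => t /=; rewrite !in_itv/= ltr_pdivrMr// ler_pdivlMr//;
  by rewrite ltrBlDr lerBrDr mulrC.
rewrite /I lebesgue_measure_itv [X in _ * X](lebesgue_measure_itv (Interval _ _))/=.
rewrite !lte_fin ltr_pM2r ?invr_gt0// ltrD2r.
case: ifP => _; last by rewrite mule0.
by rewrite -!EFinD -EFinM; congr EFin; field; rewrite gt_eqF.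
Qed.

Lemma ge0_integral_affine_line (c b : R) (f : R -> \bar R) :
  (0 < c)%R -> measurable_fun [set: R] f -> (forall t, 0 <= f t) ->
  \int[lebesgue_measure]_t f (c * t + b)%R =
  (c^-1)%:E * \int[lebesgue_measure]_t f t.
Proof.
move=> c0 mf f0.
apply: (@ge0_integral_comp_scaled _ _ (measurableTypeR R) (measurableTypeR R) R
  lebesgue_measure lebesgue_measure (fun t => c * t + b)%R) => //.
- exact: measurable_affine_line.
- by rewrite invr_ge0 ltW.
- by move=> A mA; exact: lebesgue_measure_affine.
Qed.

End change_of_variables.

Section affine_space.
Context {R : realType}.
Local Notation T := (measurableTypeR R).
Local Open Scope ereal_scope.

Definition affine {n} (c : R) (b x : n.-tuple T) : n.-tuple T :=
  [tuple (c * tnth x i + tnth b i)%R | i < n].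

Lemma measurable_affine {n} c (b : n.-tuple T) : measurable_fun [set: n.-tuple T] (affine c b).
Proof.
apply/measurable_fun_tnthP => i.
rewrite (_ : _ \o _ = fun x => (c * tnth x i + tnth b i)%R); last first.
  by apply/funext => x; rewrite /= tnth_mktuple.
apply: measurable_funD => //; apply: measurable_funM => //.
exact: measurable_tnth.
Qed.

Lemma affine_cons {n} c (b : n.+1.-tuple T) t (y : n.-tuple T) :
  affine c b (tuple_of_pair (t, y)) =
  tuple_of_pair ((c * t + thead b)%R, affine c [tuple of behead b] y).
Proof.
apply: eq_from_tnth => i; rewrite tnth_mktuple.
case: (unliftP ord0 i) => [j|] ->.
  rewrite !tnthS tnth_mktuple; congr (_ + _)%R.
  by rewrite [in LHS](tuple_eta b) tnthS.
by rewrite /tuple_of_pair !tnth0.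
Qed.

Lemma measurable_tuple_of_pair_preimage {n} (A : set (n.+1.-tuple T)) :
  measurable A -> measurable ((@tuple_of_pair R n) @^-1` A).
Proof.
by move=> mA; rewrite -[X in measurable X]setTI; exact: measurable_tuple_of_pair.
Qed.

(** By induction on the dimension: the slice at t of the preimage of A is the
    preimage of the slice of A at c * t + b_0, so the slicing formula for the
    product measure reduces the claim to the change of variables on the
    line. *)
Lemma borel_lebesgue_affine {n} (c : R) (b : n.-tuple T) (A : set (n.-tuple T)) :
  (0 < c)%R -> measurable A ->
  borel_lebesgue R n (affine c b @^-1` A) = (c ^- n)%:E * borel_lebesgue R n A.
Proof.
move=> c0; elim: n b A => [|n IH] b A mA.
  rewrite expr0 invr1 mul1e /= !diracE; congr (_%:R%:E).
  by congr nat_of_bool; apply/idP/idP; rewrite !inE/= (tuple0 (affine _ _ _)).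
have mA' := measurable_tuple_of_pair_preimage mA.
rewrite /= /cons_measure /pushforward /product_measure1.
pose g (t : R) : \bar R :=
  borel_lebesgue R n (xsection ((@tuple_of_pair R n) @^-1` A) t).
transitivity (\int[lebesgue_measure]_t ((c ^- n)%:E * g (c * t + thead b)%R)).
  apply: eq_integral => t _ /=; rewrite -(IH [tuple of behead b]); last exact: measurable_xsection.
  congr (borel_lebesgue R n _); apply/seteqP; split => y;
    by rewrite /xsection/= !inE/= affine_cons.
have mg : measurable_fun [set: T] g by exact: measurable_fun_xsection.
have g0 t : 0 <= g t by [].
rewrite ge0_integralZl//; last 2 first.
- by apply: (measurableT_comp mg); exact: measurable_affine_line.
- by rewrite lee_fin invr_ge0 exprn_ge0// ltW.
rewrite ge0_integral_affine_line//.
by rewrite muleA -EFinM -invfM -exprSr.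
Qed.

Lemma ge0_integral_affine {n} (c : R) (b : n.-tuple T) (f : n.-tuple T -> \bar R) :
  (0 < c)%R -> measurable_fun [set: _] f -> (forall x, 0 <= f x) ->
  \int[borel_lebesgue R n]_x f (affine c b x) =
  (c ^- n)%:E * \int[borel_lebesgue R n]_x f x.
Proof.
move=> c0 mf f0; apply: ge0_integral_comp_scaled => //.
- exact: measurable_affine.
- by rewrite invr_ge0 exprn_ge0// ltW.
- by move=> A mA; exact: borel_lebesgue_affine.
Qed.

End affine_space.

(** * The Euclidean distance *)

Notation eudist := Defs.edist.

Section euclidean_distance.
Context {R : realType}.
Local Notation T := (measurableTypeR R).

Lemma eudist_ge0 {n} (x y : n.-tuple T) : 0 <= eudist x y.
Proof. exact: sqrtr_ge0. Qed.

Lemma eudistC {n} (x y : n.-tuple T) : eudist x y = eudist y x.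
Proof. by rewrite /Defs.edist; under eq_bigr do rewrite -sqrrN opprB. Qed.

Lemma sqr_eudist {n} (x y : n.-tuple T) :
  eudist x y ^+ 2 = \sum_(i < n) (tnth x i - tnth y i) ^+ 2.
Proof. by rewrite sqr_sqrtr// sumr_ge0// => i _; exact: sqr_ge0. Qed.

Lemma eudist_eq0 {n} (x y : n.-tuple T) : eudist x y = 0 -> x = y.
Proof.
move=> xy0; apply: eq_from_tnth => i; apply/eqP.
have /eqP := sqr_eudist x y.
rewrite xy0 expr0n/= eq_sym psumr_eq0; last by move=> j _; exact: sqr_ge0.
by move=> /allP/(_ i (mem_index_enum _)); rewrite sqrf_eq0 subr_eq0.
Qed.

Lemma ler_norm_eudist {n} (x y : n.-tuple T) i :
  `|tnth x i - tnth y i| <= eudist x y.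
Proof.
rewrite -ler_sqr ?nnegrE ?eudist_ge0// real_normK ?num_real// sqr_eudist.
by rewrite (bigD1 i)//= lerDl sumr_ge0// => j _; exact: sqr_ge0.
Qed.

Lemma eudist_le {n} (x y : n.-tuple T) (e : R) :
  (forall i, `|tnth x i - tnth y i| <= e) -> eudist x y <= n%:R * e.
Proof.
case: n x y => [|n] x y xye; first by rewrite /Defs.edist big_ord0 sqrtr0 mul0r.
have e0 : 0 <= e by apply: le_trans (xye ord0).
rewrite -ler_sqr ?nnegrE ?eudist_ge0 ?mulr_ge0// sqr_eudist.
apply: (@le_trans _ _ (\sum_(i < n.+1) e ^+ 2)).
  apply: ler_sum => i _; rewrite -[leLHS]real_normK ?num_real//.
  by rewrite ler_sqr ?nnegrE.
rewrite sumr_const card_ord exprMn -natrX -[leLHS]mulr_natl ler_wpM2r ?sqr_ge0//.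
by rewrite ler_nat leq_pmulr.
Qed.

Lemma eudist_triangle {n} (x y z : n.-tuple T) :
  eudist x z <= eudist x y + eudist y z.
Proof.
set a := eudist x y; set b := eudist y z.
have a0 : 0 <= a by exact: eudist_ge0.
have b0 : 0 <= b by exact: eudist_ge0.
rewrite -ler_sqr ?nnegrE ?eudist_ge0 ?addr_ge0//.
(* It remains to prove Cauchy-Schwarz, s <= a * b; when a * b > 0 it follows
   from the nonnegativity of the sum of the (b u_i - a v_i) ^+ 2. *)
pose s := \sum_(i < n) (tnth x i - tnth y i) * (tnth y i - tnth z i).
have -> : eudist x z ^+ 2 = a ^+ 2 + s *+ 2 + b ^+ 2.
  rewrite !sqr_eudist -sumrMnl -!big_split/=; apply: eq_bigr => i _.
  by rewrite -sqrrD; congr (_ ^+ 2); ring.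
rewrite sqrrD lerD2r lerD2l lerMn2r/=.
have [ab0|ab0] := ltP 0 (a * b).
  rewrite -subr_ge0 -(pmulr_rge0 _ ab0) -(pmulrn_lge0 _ (ltn0Sn 1)).
  suff -> : (a * b * (a * b - s)) *+ 2 =
      \sum_(i < n) (b * (tnth x i - tnth y i) - a * (tnth y i - tnth z i)) ^+ 2.
    by apply: sumr_ge0 => i _; exact: sqr_ge0.
  transitivity (b ^+ 2 * (\sum_(i < n) (tnth x i - tnth y i) ^+ 2) -
      (a * b *+ 2) * s + a ^+ 2 * (\sum_(i < n) (tnth y i - tnth z i) ^+ 2)).
    by rewrite -!sqr_eudist -/a -/b; ring.
  rewrite /s !mulr_sumr -sumrN -!big_split/=.
  by apply: eq_bigr => i _; ring.
have {ab0} : a * b == 0 by rewrite eq_le ab0 mulr_ge0.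
rewrite /s mulf_eq0 => /orP[/eqP/eudist_eq0 xy|/eqP/eudist_eq0 yz].
  by rewrite big1 ?mulr_ge0// => i _; rewrite xy subrr mul0r.
by rewrite big1 ?mulr_ge0// => i _; rewrite yz subrr mulr0.
Qed.

Lemma eudist_affine {n} (c : R) (b x y : n.-tuple T) : 0 <= c ->
  eudist (affine c b x) (affine c b y) = c * eudist x y.
Proof.
move=> c0; rewrite -[c in RHS]ger0_norm// -sqrtr_sqr -sqrtrM ?sqr_ge0// mulr_sumr.
rewrite /Defs.edist; congr Num.sqrt.
by apply: eq_bigr => i _; rewrite !tnth_mktuple -exprMn; congr (_ ^+ 2); ring.
Qed.

Definition origin {n} : n.-tuple T := [tuple 0 | i < n].

Lemma affine_origin {n} (c : R) (b : n.-tuple T) : affine c b origin = b.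
Proof.
by apply: eq_from_tnth => i; rewrite !tnth_mktuple mulr0 add0r.
Qed.

Lemma measurable_eudist {d} {X : measurableType d} {n} (x : n.-tuple T)
    (f : X -> n.-tuple T) :
  (forall i, measurable_fun [set: X] (fun z => tnth (f z) i)) ->
  measurable_fun [set: X] (fun z => eudist x (f z)).
Proof.
move=> mf.
have msqrt : measurable_fun [set: R] (@Num.sqrt R).
  by apply: continuous_measurable_fun; exact: sqrt_continuous.
apply: (measurableT_comp msqrt).
apply: measurable_sum => i; apply: measurable_funX.
by apply: measurable_funB => //; exact: mf.
Qed.

Lemma measurable_eudist_tuple {n} (x : n.-tuple T) :
  measurable_fun [set: n.-tuple T] (eudist x : n.-tuple T -> R).
Proof. by apply: (@measurable_eudist _ _ _ _ id) => i; exact: measurable_tnth. Qed.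

End euclidean_distance.
Arguments origin {R n}.

(** * Volumes of balls *)

Section balls.
Context {R : realType}.
Local Notation T := (measurableTypeR R).
Local Notation mu n := (borel_lebesgue R n).
Local Open Scope ereal_scope.

Definition eball {n} (x : n.-tuple T) (r : R) : set (n.-tuple T) :=
  [set y | (eudist x y < r)%R].

Lemma measurable_eball {n} (x : n.-tuple T) r : measurable (eball x r).
Proof.
rewrite -[X in measurable X]setTI.
rewrite (_ : eball x r = eudist x @^-1` [set` Interval (BInfty _ true) (BLeft r)]).
  exact: (measurable_eudist_tuple x measurableT).
by apply/seteqP; split => y; rewrite /eball/= in_itv.
Qed.

Lemma measurable_tuple1 {n} (x : n.-tuple T) : measurable [set x].
Proof.
rewrite -[X in measurable X]setTI.
rewrite (_ : [set x] = eudist x @^-1` [set 0%R]).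
  by apply: (measurable_eudist_tuple x measurableT).
apply/seteqP; split => y /=; last by move/eudist_eq0.
by move=> ->; rewrite /Defs.edist big1 ?sqrtr0// => i _; rewrite subrr expr0n.
Qed.

(** A set containing the unit ball whose measure is a product. *)
Definition unit_cube n : set (n.-tuple T) :=
  [set x | forall i, (`|tnth x i| <= 1)%R].

Arguments unit_cube : clear implicits.

Lemma unit_cube_cons n : (@tuple_of_pair R n) @^-1` unit_cube n.+1 =
  [set` Interval (BLeft (-1)%R) (BRight 1%R)] `*` unit_cube n.
Proof.
apply/seteqP; split => -[t y] /=; rewrite /unit_cube/= in_itv/= -ler_norml.
  move=> ty; split; first by have := ty ord0; rewrite tnth0.
  by move=> i; have := ty (lift ord0 i); rewrite tnthS.
move=> [t1 y1] i; case: (unliftP ord0 i) => [j|] ->.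
  by rewrite tnthS.
by rewrite tnth0.
Qed.

Lemma measurable_unit_cube n : measurable (unit_cube n).
Proof.
rewrite (_ : unit_cube n =
    \bigcap_(i in [set: 'I_n]) ((fun x : n.-tuple T => tnth x i) @^-1`
     [set` Interval (BLeft (-1)%R) (BRight 1%R)])).
  apply: fin_bigcap_measurable => // i _; rewrite -[X in measurable X]setTI.
  by apply: measurable_tnth => //; exact: measurable_itv.
apply/seteqP; split => x /=.
  by move=> x1 i _ /=; rewrite in_itv/= -ler_norml.
by move=> x1 i; have := x1 i Logic.I; rewrite /= in_itv/= -ler_norml.
Qed.

Lemma unit_cube_lty n : mu n (unit_cube n) < +oo.
Proof.
elim: n => [|n IH].
  rewrite /= diracE; case: (_ \in _) => //; exact: ltry.
rewrite /= /cons_measure /pushforward unit_cube_cons product_measure1E//.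
- have I2 : lebesgue_measure [set` Interval (BLeft (-1)%R) (BRight (1 : R)%R)] = 2%:E.
    rewrite lebesgue_measure_itv/= lte_fin ifT; last by lra.
    by rewrite -EFinB; congr EFin; lra.
  by rewrite [X in X * _ < _](_ : _ = 2%:E) ?lte_mul_pinfty// lee_fin.
- exact: measurable_unit_cube.
Qed.

Lemma borel_lebesgue_setT n : (0 < n)%N -> mu n [set: _] = +oo.
Proof.
elim: n => // n IH _.
rewrite /= /cons_measure /pushforward preimage_setT -setXTT.
rewrite product_measure1E//.
have RE : lebesgue_measure [set: R] = +oo.
  by rewrite -set_itvNyy lebesgue_measure_itv.
rewrite [X in X * _](_ : _ = +oo)//.
case: n IH => [|n] IH; last by rewrite IH// mulyy.
by rewrite /= diracT mule1.
Qed.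

Definition ball_volume n : R := fine (mu n (eball origin 1)).

Lemma eball_origin1_lty n : mu n (eball origin 1) < +oo.
Proof.
apply: le_lt_trans (unit_cube_lty n); apply: le_measure.
- by rewrite inE; exact: measurable_eball.
- by rewrite inE; exact: measurable_unit_cube.
move=> y /ltW y1 i; apply: le_trans y1.
by have := ler_norm_eudist origin y i; rewrite tnth_mktuple sub0r normrN.
Qed.

Lemma ball_volume_ge0 n : (0 <= ball_volume n)%R.
Proof. by rewrite fine_ge0. Qed.

Lemma measure_eball n (x : n.-tuple T) (r : R) : (0 < r)%R ->
  mu n (eball x r) = (r ^+ n * ball_volume n)%:E.
Proof.
move=> r0; have /= := borel_lebesgue_affine x r0 (measurable_eball x r).
have -> : affine r x @^-1` eball x r = eball origin 1.
  apply/seteqP; split => y; rewrite /eball/= -{1}(affine_origin r x) eudist_affine ?ltW//;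
  by rewrite gtr_pMr.
move=> volE; rewrite EFinM /ball_volume fineK; last first.
  by rewrite ge0_fin_numE//; exact: eball_origin1_lty.
rewrite volE muleA -EFinM mulfV ?mul1e// expf_neq0// gt_eqF//.
Qed.

(** A point lies in balls of arbitrarily small volume. *)
Lemma measure_tuple1 n (x : n.-tuple T) : (0 < n)%N -> mu n [set x] = 0.
Proof.
move=> n0; apply/eqP; rewrite eq_le measure_ge0 andbT.
apply/lee_addgt0Pr => e e0; rewrite add0e.
have V0 := ball_volume_ge0 n.
pose r := (Num.min 1 (e / (ball_volume n + 1)))%R.
have r0 : (0 < r)%R by rewrite lt_min ltr01 divr_gt0// ltr_pwDr.
apply: (@le_trans _ _ (mu n (eball x r))).
  apply: le_measure; rewrite ?inE; [exact: measurable_tuple1|exact: measurable_eball|].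
  move=> _ ->; rewrite /eball/= /Defs.edist big1 ?sqrtr0// => i _.
  by rewrite subrr expr0n.
rewrite measure_eball// lee_fin.
have r1 : (r <= 1)%R by rewrite /r ge_min lexx.
have re : (r <= e / (ball_volume n + 1))%R by rewrite /r ge_min lexx orbT.
have rn : (r ^+ n <= r)%R by rewrite -[leRHS]expr1 ler_wiXn2l// ltW.
apply: le_trans (ler_wpM2r V0 (le_trans rn re)) _.
rewrite mulrAC ler_pdivrMr ?ltr_pwDr// ler_pM2l//; lra.
Qed.

Lemma measurable_radial n (x : n.-tuple T) (g : R -> \bar R) :
  measurable_fun [set: R] g ->
  measurable_fun [set: n.-tuple T] (fun y => g (eudist x y)).
Proof. by move=> mg; exact: measurableT_comp mg (measurable_eudist_tuple x). Qed.

Lemma ge0_integral_radial_shift n (x : n.-tuple T) (g : R -> \bar R) :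
  measurable_fun [set: R] g -> (forall r, 0 <= g r) ->
  \int[mu n]_y g (eudist x y) = \int[mu n]_y g (eudist origin y).
Proof.
move=> mg g0.
have := @ge0_integral_affine _ n 1 x _ ltr01 (measurable_radial x mg) (fun y => g0 _).
rewrite expr1n invr1 mul1e => <-; apply: eq_integral => y _.
by rewrite -{1}(affine_origin 1 x) eudist_affine// mul1r.
Qed.

Lemma ge0_integral_radial_dilation n (c : R) (g : R -> \bar R) :
  (0 < c)%R -> measurable_fun [set: R] g -> (forall r, 0 <= g r) ->
  \int[mu n]_y g (c * eudist origin y)%R =
  (c ^- n)%:E * \int[mu n]_y g (eudist origin y).
Proof.
move=> c0 mg g0.
rewrite -(@ge0_integral_affine _ n c origin _ c0 (measurable_radial origin mg))//.
apply: eq_integral => y _.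
by rewrite -{2}(affine_origin c origin) eudist_affine// ltW.
Qed.

End balls.

(** * Radial integrals *)

Section radial_integral.
Context {R : realType}.
Local Notation T := (measurableTypeR R).
Local Notation mu n := (borel_lebesgue R n).

(** Powers with negative exponents and the profile phi are only controlled on
    the half-line; extending them by 0 makes them measurable on the line. *)
Lemma measurable_fun_pos_continuous (f : R -> R) :
  (forall r, 0 < r -> {for r, continuous f}) ->
  measurable_fun [set: R] (fun r => if 0 < r then f r else 0).
Proof.
move=> cf; apply: measurable_fun_if => //.
  exact: measurable_fun_ltr.
rewrite setTI (_ : _ @^-1` _ = `]0, +oo[%classic); last first.
  by apply/seteqP; split => r /=; rewrite in_itv/= andbT.
apply: open_continuous_measurable_fun; first exact: interval_open.
by move=> r; rewrite inE/= in_itv/= andbT; exact: cf.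
Qed.

Lemma measurable_pos_inv :
  measurable_fun [set: R] (fun r => if 0 < r then r^-1 else 0).
Proof.
apply: measurable_fun_pos_continuous => r r0.
by apply: inv_continuous; rewrite gt_eqF.
Qed.

Local Open Scope ereal_scope.

Lemma integral_pos_mkcond (f : R -> R) :
  \int[lebesgue_measure]_(t in `]0%R, +oo[) (f t)%:E =
  \int[lebesgue_measure]_t (if (0 < t)%R then f t else 0%R)%:E.
Proof.
rewrite integral_mkcond; apply: eq_integral => t _.
rewrite patchE; case: ifPn; first by rewrite inE/= in_itv/= andbT => ->.
by rewrite notin_setE/= in_itv/= andbT => /negP/negbTE ->.
Qed.

Lemma integral_pos_dilation n (c : R) (g : R -> R) :
  (0 < c)%R -> measurable_fun [set: R] g -> (forall r, 0 <= g r)%R ->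
  \int[lebesgue_measure]_(t in `]0%R, +oo[) (t ^+ n * g (c * t))%:E =
  (c ^- n.+1)%:E * \int[lebesgue_measure]_(t in `]0%R, +oo[) (t ^+ n * g t)%:E.
Proof.
move=> c0 mg g0; rewrite !integral_pos_mkcond.
pose F (u : R) := (if (0 < u)%R then u ^+ n * g u else 0)%R.
have mF : measurable_fun [set: R] F.
  apply: measurable_fun_ifT => //; first exact: measurable_fun_ltr.
  exact: measurable_funM.
have F0 u : (0 <= F u)%R.
  by rewrite /F; case: ifPn => // u0; rewrite mulr_ge0// exprn_ge0// ltW.
transitivity (\int[lebesgue_measure]_t ((c ^- n)%:E * (F (c * t + 0)%R)%:E)).
  apply: eq_integral => t _; rewrite addr0 -EFinM /F pmulr_rgt0//.
  case: ifPn => _; last by rewrite mulr0.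
  by rewrite exprMn !mulrA mulVf ?mul1r// expf_neq0// gt_eqF.
rewrite ge0_integralZl_EFin//; last 3 first.
- by move=> t _; rewrite lee_fin.
- apply/measurable_EFinP; apply: measurableT_comp mF _.
  exact: measurable_affine_line.
- by rewrite invr_ge0 exprn_ge0// ltW.
rewrite (ge0_integral_affine_line _ c0 (f := EFin \o F))//; last exact/measurable_EFinP.
by rewrite muleA -EFinM -invfM -exprSr.
Qed.

(** A substitute for polar coordinates, in dimension n.+1.  For y <> 0 the
    interval ]|y| / 2, |y|] has dt / t-measure at least 1 / 2, so g(|y|) is at
    most twice the integral of g(|y|) 1_{t <= |y| < 2 t} dt / t.  After
    exchanging the integrals, y = t w confines w to the shell 1 <= |w| < 2;
    after exchanging them again, t |w| = s turns the integral in t into at most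
    the one-dimensional integral.  The shell is estimated by the ball of
    radius 2. *)
Lemma ge0_integral_radial_le n (g : R -> R) :
  measurable_fun [set: R] g -> (forall r, 0 <= g r)%R ->
  (forall r, r <= 0 -> g r = 0)%R ->
  \int[mu n.+1]_y (g (eudist origin y))%:E <=
  (2 ^+ n.+2 * ball_volume n.+1)%:E *
    \int[lebesgue_measure]_(t in `]0%R, +oo[) (t ^+ n * g t)%:E.
Proof.
move=> mg g0 gneg.
set I := \int[lebesgue_measure]_(t in `]0%R, +oo[) _.
have I0 : 0 <= I.
  apply: integral_ge0 => t /=; rewrite in_itv/= andbT => t0.
  by rewrite lee_fin mulr_ge0// exprn_ge0// ltW.
pose pinv (t : R) := (if (0 < t)%R then t^-1 else 0)%R.
have pinv0 t : (0 <= pinv t)%R.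
  by rewrite /pinv; case: ifPn => // t0; rewrite invr_ge0 ltW.
pose norm (y : n.+1.-tuple T) : R := eudist origin y.
pose shell (t r : R) := ((t <= r) && (r < 2 * t))%R.
pose G (t r : R) := (if shell t r then g r else 0)%R.
have G0 t r : (0 <= G t r)%R by rewrite /G; case: ifP.
pose K (z : T * n.+1.-tuple T) : \bar R := (pinv z.1 * G z.1 (norm z.2))%:E.
have K0 z : 0 <= K z by rewrite lee_fin mulr_ge0.
have mnorm2 : measurable_fun [set: T * n.+1.-tuple T] (fun z => norm z.2).
  apply: (@measurable_eudist _ _ _ _ origin snd) => i.
  exact: (measurableT_comp (measurable_tnth i)).
have m1 : measurable_fun [set: T * n.+1.-tuple T] (fun z => z.1 : R).
  exact: measurable_fst.
have mK : measurable_fun [set: _] K.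
  apply/measurable_EFinP; apply: measurable_funM.
    exact: measurableT_comp measurable_pos_inv m1.
  apply: measurable_fun_ifT.
  - apply: measurable_and; first exact: measurable_fun_ler.
    by apply: measurable_fun_ltr => //; exact: measurable_funM.
  - exact: measurableT_comp mg mnorm2.
  - exact: measurable_cst.
have mKt y : measurable_fun [set: T] (fun t => K (t, y)).
  by apply: measurableT_comp mK _; exact: measurable_pair2.
(* the factor 2 compensates for the interval having measure at least 1 / 2 *)
have step1 y : (g (norm y))%:E <= 2%:E * \int[lebesgue_measure]_t K (t, y).
  have [r0|r0] := lerP (norm y) 0.
    by rewrite gneg// mule_ge0// integral_ge0.
  set r := norm y in r0 *.
  pose J : set R := [set` Interval (BRight (r / 2)) (BRight r)]%R.
  have mJ : measurable J by exact: measurable_itv.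
  apply: (@le_trans _ _ (2%:E * \int[lebesgue_measure]_(t in J) K (t, y))).
    apply: (@le_trans _ _ (2%:E * \int[lebesgue_measure]_(t in J) cst (r^-1 * g r)%:E t)).
      have JE : lebesgue_measure J = (r / 2)%:E.
        rewrite /J lebesgue_measure_itv/= lte_fin ifT; last by lra.
        by rewrite -EFinB; congr EFin; field.
      rewrite integral_cst// [X in _ * (_ * X)](_ : _ = (r / 2)%:E)//.
      rewrite -!EFinM lee_fin.
      rewrite (_ : 2 * (r^-1 * g r * (r / 2)) = g r)%R//.
      by field; rewrite gt_eqF.
    rewrite lee_pmul2l//; apply: ge0_le_integral => //.
    - by move=> t _; rewrite lee_fin mulr_ge0// invr_ge0 ltW.
    - exact: measurable_funTS.
    - move=> t; rewrite /J/= in_itv/= => /andP[rt tr].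
      have t0 : (0 < t)%R by lra.
      rewrite lee_fin /= -/r /G /shell tr /=.
      rewrite ifT; last by lra.
      by rewrite ler_wpM2r// /pinv t0 lef_pV2// posrE.
  rewrite lee_pmul2l//; apply: ge0_subset_integral => //.
pose L (z : T * n.+1.-tuple T) : R :=
  (if (1 <= norm z.2) && (norm z.2 < 2) then
     if 0 < (z.1 : R) then (z.1 : R) ^+ n * g ((z.1 : R) * norm z.2) else 0
   else 0)%R.
have L0 z : (0 <= L z)%R.
  rewrite /L; case: ifP => // _; case: ifP => // t0.
  by rewrite mulr_ge0// exprn_ge0// ltW.
have mL : measurable_fun [set: _] L.
  apply: measurable_fun_ifT => //.
    by apply: measurable_and; [exact: measurable_fun_ler|exact: measurable_fun_ltr].
  apply: measurable_fun_ifT => //; first exact: measurable_fun_ltr.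
  apply: measurable_funM; first exact: measurable_funX.
  by apply: measurableT_comp mg _; exact: measurable_funM.
(* the substitution y = t w, whose Jacobian t ^+ n.+1 meets the factor 1 / t *)
have step3 (t : R) :
    \int[mu n.+1]_y K (t, y) = \int[mu n.+1]_y (L (t, y))%:E.
  have [t0|t0] := lerP t 0.
    rewrite [RHS]integral0_eq ?[LHS]integral0_eq// => y _.
      by rewrite /K/= /pinv (le_gtF t0) mul0r.
    by rewrite /L/= (le_gtF t0) if_same.
  have mGt : measurable_fun [set: R] (G t).
    apply: measurable_fun_ifT => //.
    by apply: measurable_and; [exact: measurable_fun_ler|exact: measurable_fun_ltr].
  transitivity (\int[mu n.+1]_y ((t^-1)%:E * (G t (norm y))%:E)).
    by apply: eq_integral => y _; rewrite /K /pinv/= t0 EFinM.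
  rewrite ge0_integralZl_EFin//; last 3 first.
  - by move=> y _; rewrite lee_fin.
  - apply: (measurable_radial origin (g := EFin \o G t)).
    exact/measurable_EFinP.
  - by rewrite invr_ge0 ltW.
  transitivity (\int[mu n.+1]_y ((t ^+ n)%:E * (G t (t * norm y))%:E)).
    rewrite ge0_integralZl_EFin//; last 3 first.
    - by move=> y _; rewrite lee_fin.
    - apply: (measurable_radial origin (g := fun r => (G t (t * r))%:E)).
      apply/measurable_EFinP; apply: measurableT_comp mGt _.
      exact: measurable_funM.
    - by rewrite exprn_ge0// ltW.
    rewrite (ge0_integral_radial_dilation _ t0 (g := EFin \o G t))//; last 2 first.
    - exact/measurable_EFinP.
    - by move=> r; rewrite /= lee_fin.
    rewrite muleA -EFinM exprS invfM mulrA mulrAC mulfV ?mul1r//.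
    by rewrite expf_neq0// gt_eqF.
  apply: eq_integral => y _; rewrite -EFinM /L/= t0 /G /shell.
  rewrite ler_pMr// [(2 * t)%R]mulrC ltr_pM2l//.
  by case: ifP => _ //; rewrite mulr0.
(* the substitution s = t |w|, with |w| >= 1 *)
have step4 y : \int[lebesgue_measure]_t (L (t, y))%:E <=
    I * (\1_(eball origin 2) y)%:E.
  have [/andP[y1 y2]|ny] := boolP ((1 <= norm y) && (norm y < 2))%R; last first.
    by rewrite integral0_eq ?mule_ge0// => t _; rewrite /L (negbTE ny).
  have y0 : (0 < norm y)%R by lra.
  rewrite indicE mem_set// mule1.
  have -> : \int[lebesgue_measure]_t (L (t, y))%:E =
      \int[lebesgue_measure]_(t in `]0%R, +oo[) (t ^+ n * g (norm y * t))%:E.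
    rewrite integral_pos_mkcond; apply: eq_integral => t _.
    by rewrite /L/= y1 y2/= (mulrC (norm y)).
  rewrite (integral_pos_dilation n y0 mg g0) -/I.
  rewrite -[leRHS]mul1e lee_wpmul2r// lee_fin invf_le1 ?exprn_gt0//.
  exact: exprn_ege1.
have mI1 c : measurable_fun [set: n.+1.-tuple T] (fun y => c * (\1_(eball origin 2) y)%:E).
  apply: emeasurable_funM => //; apply/measurable_EFinP.
  by apply: measurable_indic; exact: measurable_eball.
apply: (@le_trans _ _ (\int[mu n.+1]_y (2%:E * \int[lebesgue_measure]_t K (t, y)))).
  apply: ge0_le_integral => //.
  - by move=> y _; rewrite lee_fin.
  - apply: (measurable_radial origin (g := EFin \o g)).
    exact/measurable_EFinP.
  - apply: emeasurable_funM => //.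
    exact: (measurable_fun_fubini_tonelli_G (m1 := lebesgue_measure) K mK K0).
rewrite ge0_integralZl_EFin//; last 2 first.
- by move=> y _; exact: integral_ge0.
- exact: (measurable_fun_fubini_tonelli_G (m1 := lebesgue_measure) K mK K0).
rewrite -(fubini_tonelli (m1 := lebesgue_measure) (m2 := mu n.+1) K mK)//.
under eq_integral do rewrite step3.
have LE0 z : 0 <= (EFin \o L) z by rewrite /= lee_fin.
have mLE : measurable_fun [set: _] (EFin \o L) by exact/measurable_EFinP.
rewrite (fubini_tonelli (m1 := lebesgue_measure) (m2 := mu n.+1) (EFin \o L) mLE); last first.
  by move=> z; rewrite lee_fin.
apply: (@le_trans _ _ (2%:E * \int[mu n.+1]_y (I * (\1_(eball origin 2) y)%:E))).
  rewrite lee_pmul2l//; apply: ge0_le_integral => //.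
  - by move=> y _; apply: integral_ge0 => t _; rewrite lee_fin.
  - exact: (measurable_fun_fubini_tonelli_G (m1 := lebesgue_measure) (EFin \o L) mLE LE0).
  - by move=> y _; exact: step4.
have -> : \int[mu n.+1]_y (I * (\1_(eball origin 2) y)%:E) =
    I * \int[mu n.+1]_y (\1_(eball origin 2) y)%:E.
  apply: ge0_integralZl => //.
    by apply/measurable_EFinP; apply: measurable_indic; exact: measurable_eball.
rewrite integral_indic//; last exact: measurable_eball.
rewrite setIT [X in _ * (_ * X)](_ : _ = (2 ^+ n.+1 * ball_volume n.+1)%:E).
  by rewrite muleCA -EFinM mulrA -exprS muleC.
exact: measure_eball.
Qed.

End radial_integral.

(** * Decay away from a ball *)

Section tail.
Context {R : realType}.
Local Notation T := (measurableTypeR R).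
Local Notation mu n := (borel_lebesgue R n).

(** Moving a mass by at most rho lowers the value of a kernel of the class at
    distance r >= rho by at most a multiple of tail n rho r, n being the
    dimension. *)
Definition tail (n : nat) (rho r : R) : R :=
  if rho <= r then (if 0 < r then rho / r ^+ n.+1 else 0) else 0.

Lemma tail_ge0 n rho r : 0 <= rho -> 0 <= tail n rho r.
Proof.
move=> rho0; rewrite /tail; case: ifP => // _; case: ifP => // r0.
by rewrite divr_ge0// exprn_ge0// ltW.
Qed.

Lemma continuous_divX (c : R) k (t : R) : 0 < t ->
  {for t, continuous (fun t : R => c / t ^+ k)}.
Proof.
move=> t0; apply: continuousM; first exact: cvg_cst.
by apply: continuousV; [rewrite expf_neq0// gt_eqF|exact: exprn_continuous].
Qed.

Lemma measurable_tail n rho : measurable_fun [set: R] (tail n rho).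
Proof.
apply: measurable_fun_ifT => //; first exact: measurable_fun_ler.
apply: measurable_fun_pos_continuous => r r0.
exact: continuous_divX.
Qed.

Lemma integral_tail n rho : 0 < rho ->
  (\int[lebesgue_measure]_(t in `]0%R, +oo[) (t ^+ n * tail n.+1 rho t)%:E = 1)%E.
Proof.
move=> rho0; rewrite integral_pos_mkcond.
transitivity (\int[lebesgue_measure]_(t in `[rho, +oo[) (rho / t ^+ 2)%:E)%E.
  rewrite [RHS]integral_mkcond; apply: eq_integral => t _.
  rewrite patchE mem_setE in_itv/= andbT /tail.
  case: (leP rho t) => [rt|_]; last by rewrite mulr0 if_same.
  have t0 : 0 < t by exact: lt_le_trans rt.
  rewrite t0; congr EFin; rewrite mulrCA; congr (_ * _).
  by rewrite -addn2 exprD invfM mulrA mulfV ?mul1r// expf_neq0// gt_eqF.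
pose F (t : R) : R := (- rho) *: t^-1.
have dF (t : R) : 0 < t -> is_derive t (1 : R) F (rho / t ^+ 2).
  move=> t0; have tn0 : t != 0 by rewrite gt_eqF.
  have h := @is_deriveV R id t 1 1 tn0 (is_derive_id _ _).
  have := is_deriveZ (- rho) h; rewrite /= => {}h.
  apply: (@is_derive_eq _ _ _ _ _ _ _ _ h).
  by rewrite scalerA mulrNN [_ *: _]mulr1.
rewrite (@ge0_continuous_FTC2y _ (fun t => rho / t ^+ 2) F rho 0).
- by rewrite /F scaleNr -EFinB sub0r opprK [_ *: _]mulfV// gt_eqF.
- by move=> x rx; rewrite divr_ge0 ?sqr_ge0// ltW.
- apply: continuous_in_subspaceT => t; rewrite inE/= in_itv/= andbT => rt.
  have t0 : 0 < t by exact: lt_le_trans rt.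
  exact: continuous_divX.
- rewrite -[X in _ --> X](scaler0 _ (- rho)); apply: cvgZr.
  apply/gtr0_cvgV0; last exact: cvg_id.
  exact: nbhs_pinfty_gt.
- move=> x rx; have x0 : 0 < x by exact: lt_trans rx.
  by have [] := dF _ x0.
- apply: cvg_at_right_filter. 
  have [h _] := dF _ rho0.
  by apply: differentiable_continuous; apply/derivable1_diffP.
- move=> x; rewrite in_itv/= andbT => rx; have x0 : 0 < x by exact: lt_trans rx.
  by rewrite derive1E; have [_ ->] := dF _ x0.
Qed.

Local Open Scope ereal_scope.

Lemma integral_tail_le n (x : n.+1.-tuple T) rho : (0 < rho)%R ->
  \int[mu n.+1]_y (tail n.+1 rho (eudist x y))%:E <=
  (2 ^+ n.+2 * ball_volume n.+1)%:E.
Proof.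
move=> rho0.
rewrite (ge0_integral_radial_shift x (g := EFin \o tail n.+1 rho)); last 2 first.
- by apply/measurable_EFinP; exact: measurable_tail.
- by move=> r; rewrite lee_fin tail_ge0// ltW.
apply: le_trans (ge0_integral_radial_le _ _ _ _) _.
- exact: measurable_tail.
- by move=> r; rewrite tail_ge0// ltW.
- by move=> r r0; rewrite /tail leNgt (le_lt_trans r0 rho0).
by rewrite integral_tail// mule1.
Qed.

End tail.

(** * Balls of prescribed residual mass *)

Section ball_of_given_mass.
Context {R : realType}.
Local Notation T := (measurableTypeR R).
Local Notation mu n := (borel_lebesgue R n).
Local Open Scope ereal_scope.

Lemma eball_subset {n} (x : n.-tuple T) (r s : R) : (r <= s)%R ->
  eball x r `<=` eball x s.
Proof. by move=> rs y /lt_le_trans; apply. Qed.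

Lemma measure_eball0 n (x : n.+1.-tuple T) (r : R) : (0 <= r)%R ->
  mu n.+1 (eball x r) = (r ^+ n.+1 * ball_volume n.+1)%:E.
Proof.
rewrite le_eqVlt => /predU1P[<-|]; last exact: measure_eball.
rewrite expr0n/= mul0r (_ : eball x 0 = set0) ?measure0//.
by apply/seteqP; split => y //=; rewrite /eball/= ltNge eudist_ge0.
Qed.

(** Intermediate value theorem: as a function of rho the measure varies no
    faster than the volume of the ball, and it grows from 0 to +oo because D
    has finite measure. *)
Lemma eball_of_measure n (x : n.+1.-tuple T) (D : set (n.+1.-tuple T)) (a : R) :
  measurable D -> mu n.+1 D < +oo -> (0 < a)%R ->
  exists2 rho : R, (0 < rho)%R & mu n.+1 (eball x rho `\` D) = a%:E.
Proof.
move=> mD Dlty a0.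
have mB r : measurable (eball x r `\` D).
  by apply: measurableD => //; exact: measurable_eball.
have Bfin (r : R) : (0 <= r)%R -> mu n.+1 (eball x r `\` D) \is a fin_num.
  move=> r0; rewrite ge0_fin_numE//.
  apply: (@le_lt_trans _ _ (mu n.+1 (eball x r))).
    by apply: le_measure; rewrite ?inE; [| exact: measurable_eball | exact: subDsetl].
  by rewrite measure_eball0// ltry.
pose V : R := ball_volume n.+1.
(* The absolute value makes f continuous on the whole line. *)
pose f (r : R) : R := fine (mu n.+1 (eball x `|r| `\` D)).
pose p (r : R) : R := (`|r| ^+ n.+1 * V)%R.
have BE r : mu n.+1 (eball x `|r|) = (p r)%:E by rewrite measure_eball0.
have Blty (r : R) : mu n.+1 (eball x `|r|) < +oo by rewrite BE ltry.
have f_le (r s : R) : (`|r| <= `|s|)%R -> (f r <= f s <= f r + (p s - p r))%R.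
  move=> rs.
  have pD : mu n.+1 (eball x `|s| `\` eball x `|r|) = (p s - p r)%:E.
    transitivity (mu n.+1 (eball x `|s|) - mu n.+1 (eball x `|r|)).
      rewrite measureD; last 3 first.
      - exact: measurable_eball.
      - exact: measurable_eball.
      - exact: Blty.
      by rewrite setIidr//; exact: eball_subset.
    by rewrite !BE EFinB.
  apply/andP; split.
    rewrite fine_le ?Bfin// le_measure ?inE//.
    by apply: setSD; exact: eball_subset.
  rewrite -lee_fin EFinD /f !fineK ?Bfin// -pD.
  apply: le_trans (measureU2 _ _ _) => //; last first.
    by apply: measurableD; exact: measurable_eball.
  apply: le_measure; rewrite ?inE//.
    by apply: measurableU => //; apply: measurableD; exact: measurable_eball.
  move=> y [ys yD]; have [yr|yr] := pselect (eball x `|r| y); first by left.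
  by right.
have fp (r s : R) : (`|f r - f s| <= `|p r - p s|)%R.
  wlog rs : r s / (`|r| <= `|s|)%R.
    move=> h; have [|/ltW] := leP `|r|%R `|s|%R; first exact: h.
    by move=> /h; rewrite distrC (distrC (p s)).
  have /andP[h1 h2] := f_le _ _ rs.
  rewrite distrC (distrC (p r)) !ger0_norm; lra.
have pc (r : R) : {for r, continuous (fun t : R => `|t| ^+ n.+1 * V)%R}.
  apply: (@continuousM _ R^o); last exact: cvg_cst.
  have h : {for r, continuous ((fun t : R => t ^+ n.+1)%R \o (fun t : R => `|t|%R))}.
    by apply: continuous_comp; [exact: norm_continuous|exact: exprn_continuous].
  exact: h.
have pcont : continuous p by exact: pc.
have fcont : continuous f.
  move=> r; apply/cvgrPdist_lt => e e0.
  have /cvgrPdist_lt/(_ _ e0) := pcont r.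
  by apply: filterS => s; apply: le_lt_trans; exact: fp.
have [b b0 fb] : exists2 b : R, (0 <= b)%R & (a <= f b)%R.
  have UE : \bigcup_k (eball x k%:R `\` D) = ~` D.
    rewrite -setD_bigcupl (_ : \bigcup_k _ = setT) ?setTD//.
    rewrite -subTset => y _.
    exists (Num.truncn (eudist x y)).+1 => //.
    by rewrite /eball/= truncnS_gt.
  have ndB : {homo (fun k => eball x k%:R `\` D) : i j / (i <= j)%N >-> (i <= j)%O}.
    move=> i j ij; apply/subsetPset; apply: setSD; apply: eball_subset.
    by rewrite ler_nat.
  have DCy : mu n.+1 (~` D) = +oo.
    apply/eqP; rewrite -leye_eq leNgt; apply/negP => DC.
    have := borel_lebesgue_setT (R := R) (ltn0Sn n).
    rewrite -(setvU D); apply/eqP; rewrite lt_eqF//.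
    apply: le_lt_trans (measureU2 _ _ _) _ => //; first exact: measurableC.
    exact: lte_add_pinfty.
  have mU : measurable (\bigcup_k (eball x k%:R `\` D)) by exact: bigcupT_measurable.
  have := @nondecreasing_cvg_mu _ _ _ (mu n.+1) _ (fun k => mB k%:R) mU ndB.
  rewrite UE [X in _ --> X](_ : _ = +oo)//.
  move/cvgeyPge => /(_ a) [N _ /(_ N (leqnn N))] /= aN.
  exists N%:R => //; rewrite -lee_fin /f fineK ?Bfin//.
  by rewrite ger0_norm.
have f0 : f 0%R = 0%R.
  have := f_le 0%R 0%R (lexx _).
  rewrite /f normr0 (_ : eball x 0 = set0) ?set0D ?measure0//.
  by apply/seteqP; split => y //=; rewrite /eball/= ltNge eudist_ge0.
have [|rho] := IVT b0 (continuous_subspaceT fcont) (v := a).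
  by rewrite f0 ge_min (ltW a0)/= le_max fb orbT.
rewrite in_itv/= => /andP[rho0 _] frho.
have {}rho0 : (0 < rho)%R.
  by rewrite lt_neqAle rho0 andbT; apply/eqP => h; move: frho a0; rewrite -h f0 => <-; rewrite ltxx.
exists rho => //; rewrite -frho /f fineK ?ger0_norm// ?Bfin// ?ltW//.
Qed.

End ball_of_given_mass.

(** * Weak type for finite sums of point masses *)

Section point_masses.
Context {R : realType}.
Local Notation T := (measurableTypeR R).
Local Notation mu n := (borel_lebesgue R n).

(** The conditions are those invariant under r |-> e ^- n * k (r / e): size,
    regularity and integral of the radial kernel k(|y|) in dimension n. *)
Definition cz_kernel (n : nat) (A : R) (k : R -> R) : Prop :=
  [/\ measurable_fun [set: R] k,
      (forall r, 0 <= k r),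
      (forall r, 0 < r -> k r * r ^+ n <= A),
      (forall r s, 0 < r -> r <= s -> `|k r - k s| * r ^+ n.+1 <= A * (s - r)) &
      (\int[mu n]_y (k (eudist origin y))%:E <= A%:E)%E].

(** The power 2 ^+ n.+1 is the price for replacing the smaller of r and s,
    which is at least r / 2, by r. *)
Lemma cz_kernel_diff n (A : R) k (rho r s : R) : cz_kernel n A k -> 0 <= A ->
  0 < r -> r / 2 <= s -> `|r - s| <= rho ->
  `|k r - k s| * r ^+ n.+1 <= 2 ^+ n.+1 * A * rho.
Proof.
move=> [_ _ _ lipk _] A0 r0 rs rsrho.
have s0 : 0 < s by lra.
have rho0 : 0 <= rho by apply: le_trans rsrho.
have [{}rs|sr] := leP r s.
  apply: (le_trans (lipk _ _ r0 rs)).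
  apply: (@le_trans _ _ (A * rho)).
    by rewrite ler_wpM2l//; apply: le_trans rsrho; rewrite distrC ler_norm.
  by rewrite ler_wpM2r// ler_peMl// exprn_ege1//; lra.
have -> : r = 2 * (r / 2) by field.
rewrite exprMn mulrCA -mulrA ler_wpM2l ?exprn_ge0//.
have -> : 2 * (r / 2) = r by field.
apply: (@le_trans _ _ (`|k s - k r| * s ^+ n.+1)).
  rewrite distrC ler_wpM2l// lerXn2r// nnegrE; lra.
apply: (le_trans (lipk _ _ s0 (ltW sr))).
by rewrite ler_wpM2l//; apply: le_trans rsrho; rewrite ler_norm.
Qed.

Local Open Scope ereal_scope.

(** The first factor is the constant of the error in [point_mass_le], the
    second one the bound on its integral in [integral_tail_le]. *)
Definition dirac_cst (n : nat) (A : R) : R :=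
  (2 ^+ n.+2 * A * (2 ^+ n.+2 * ball_volume n.+1))%R.

Lemma measurable_cz_kernel n A k z : cz_kernel n A k ->
  measurable_fun [set: n.-tuple T] (fun y => (k (eudist z y))%:E).
Proof.
case=> mk _ _ _ _; apply: (measurable_radial z (g := EFin \o k)).
exact/measurable_EFinP.
Qed.

(** The mass a at x is compared with the density lam on E.  If z is at distance
    at least 2 * rho from x, all points of E are at comparable distance from z
    and the Lipschitz bound applies.  In the shell between rho and 2 * rho the
    size bound A / r ^+ n.+1 is itself of the order of the error term. *)
Lemma point_mass_le n (A lam : R) (x z : n.+1.-tuple T) (a rho : R)
    (E : set (n.+1.-tuple T)) (k : R -> R) :
  (0 <= A)%R -> (0 < lam)%R -> (0 < a)%R -> (0 < rho)%R -> cz_kernel n.+1 A k ->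
  measurable E -> E `<=` eball x rho -> mu n.+1 E = (a / lam)%:E ->
  (rho <= eudist x z)%R ->
  (a * k (eudist z x))%:E <= lam%:E * \int[mu n.+1]_(y in E) (k (eudist z y))%:E +
    (2 ^+ n.+2 * A * a * tail n.+1 rho (eudist x z))%:E.
Proof.
move=> A0 lam0 a0 rho0 ck mE Erho muE rhoz.
have [mk k0 kA lipk kint] := ck.
rewrite (eudistC z x); set r := eudist x z in rhoz *.
have r0 : (0 < r)%R by exact: lt_le_trans rhoz.
set c := (2 ^+ n.+2 * A)%R.
have c0 : (0 <= c)%R by rewrite mulr_ge0// exprn_ge0.
have tailE : tail n.+1 rho r = (rho / r ^+ n.+2)%R by rewrite /tail rhoz r0.
have t0 : (0 <= tail n.+1 rho r)%R by rewrite tail_ge0// ltW.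
have [r2|r2] := ltP r (2 * rho)%R.
  rewrite -[leLHS]add0e leeD//.
    by rewrite mule_ge0 ?lee_fin ?(ltW lam0)// integral_ge0// => y _; rewrite lee_fin.
  rewrite lee_fin -mulrA mulrCA ler_wpM2l ?(ltW a0)// tailE mulrA.
  rewrite ler_pdivlMr ?exprn_gt0// exprSr mulrA.
  apply: (@le_trans _ _ (A * (2 * rho))%R).
    by rewrite ler_pM ?mulr_ge0 ?exprn_ge0 ?(ltW r0) ?(ltW r2)// kA.
  rewrite /c -mulrA mulrCA ler_wpM2l// ler_wpM2r ?(ltW rho0)//.
  by rewrite exprS ler_peMr// exprn_ege1//; lra.
have kE y : E y -> (k r <= k (eudist z y) + c * tail n.+1 rho r)%R.
  move=> Ey; have xy := Erho _ Ey; rewrite /eball/= in xy.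
  have h1 := eudist_triangle x y z; have h2 := eudist_triangle y x z.
  rewrite -/r (eudistC y z) in h1; rewrite -/r (eudistC y x) (eudistC y z) in h2.
  have rs : (`|r - eudist z y| <= rho)%R by rewrite ler_norml; apply/andP; split; lra.
  have rs2 : (r / 2 <= eudist z y)%R by lra.
  have := cz_kernel_diff ck A0 r0 rs2 rs.
  rewrite -ler_pdivlMr ?exprn_gt0// -/c -[(c * rho / _)%R]mulrA -tailE => h.
  have := ler_norm (k r - k (eudist z y))%R; lra.
have mk1 : measurable_fun E (fun y => (k (eudist z y))%:E).
  exact: measurable_funTS (measurable_cz_kernel z ck).
have : \int[mu n.+1]_(y in E) (cst (k r)%:E y) <=
    \int[mu n.+1]_(y in E) ((k (eudist z y))%:E + (c * tail n.+1 rho r)%:E).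
  apply: ge0_le_integral => //.
  - by move=> y _; rewrite lee_fin.
  - exact: emeasurable_funD.
rewrite integral_cst// ge0_integralD//; last 2 first.
- by move=> y _; rewrite lee_fin.
- by move=> y _; rewrite lee_fin mulr_ge0.
rewrite [X in (_ * X <= _) -> _](_ : _ = (a / lam)%:E)//.
rewrite [X in (_ <= _ + X) -> _](_ : _ = (c * tail n.+1 rho r)%:E * mu n.+1 E); last first.
  by rewrite -[RHS]integral_cst.
rewrite muE => h.
have -> : (a * k r)%:E = lam%:E * ((k r)%:E * (a / lam)%:E).
  by rewrite -!EFinM; congr EFin; field; rewrite gt_eqF.
have lamE : 0 <= lam%:E by rewrite lee_fin ltW.
apply: (le_trans (lee_wpmul2l lamE h)).
have I0 : 0 <= \int[mu n.+1]_(y in E) (k (eudist z y))%:E.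
  by apply: integral_ge0 => y _; rewrite lee_fin.
have T0 : 0 <= (c * tail n.+1 rho r)%:E * (a / lam)%:E.
  rewrite -EFinM lee_fin; apply: mulr_ge0; first exact: mulr_ge0.
  by rewrite divr_ge0// ltW.
rewrite (ge0_muleDr _ I0 T0).
rewrite leeD// -!EFinM lee_fin le_eqVlt; apply/orP; left; apply/eqP.
by rewrite /c; field; rewrite gt_eqF.
Qed.

(** By induction on N, adding to D the part of a ball around the new point that
    is not yet covered, of measure a_N / lam.  Since D then contains the whole
    ball, a point off D is at distance at least rho from x_N, as
    [point_mass_le] demands.  D and the error H do not depend on the kernel,
    which is what bounds the supremum over all kernels. *)
Lemma dirac_weak n (A lam : R) (x : nat -> n.+1.-tuple T) (a : nat -> R) N :
  (0 <= A)%R -> (0 < lam)%R -> (forall i, 0 <= a i)%R ->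
  exists (D : set (n.+1.-tuple T)) (H : n.+1.-tuple T -> R),
  [/\ measurable D /\ mu n.+1 D <= ((\sum_(i < N) a i) / lam)%:E,
      measurable_fun [set: n.+1.-tuple T] H, (forall z, 0 <= H z)%R,
      \int[mu n.+1]_z (H z)%:E <= (dirac_cst n A * \sum_(i < N) a i)%:E &
      forall k z, cz_kernel n.+1 A k -> ~ D z ->
       (\sum_(i < N) a i * k (eudist z (x i)))%:E <=
        lam%:E * \int[mu n.+1]_(y in D) (k (eudist z y))%:E + (H z)%:E].
Proof.
move=> A0 lam0 a0; elim: N => [|N [D [H [[mD muD] mH H0 intH DH]]]].
  exists set0, (cst 0%R); split => //.
  - by split => //; rewrite measure0 big_ord0 mul0r.
  - by rewrite integral0 big_ord0 mulr0.
  - by move=> k z _ _; rewrite big_ord0 integral_set0 mule0 adde0.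
have := a0 N; rewrite le_eqVlt => /predU1P[aN0|aN0].
  exists D, H; split => //; rewrite ?big_ord_recr/= -?aN0 ?addr0//.
  by move=> k z ck Dz; rewrite big_ord_recr/= -aN0 mul0r addr0; exact: DH.
have [||rho rho0 muE] := @eball_of_measure R n (x N) D (a N / lam) mD.
- by apply: le_lt_trans muD _; rewrite ltry.
- by rewrite divr_gt0.
set E := eball (x N) rho `\` D in muE.
have mE : measurable E by apply: measurableD => //; exact: measurable_eball.
have mDE : measurable (D `|` E) by exact: measurableU.
pose c := (2 ^+ n.+2 * A * a N)%R.
have c0 : (0 <= c)%R by rewrite /c; do 2!(apply: mulr_ge0; last by [exact: ltW|]); exact: exprn_ge0.
have mtail : measurable_fun [set: n.+1.-tuple T] (fun z => tail n.+1 rho (eudist (x N) z)).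
  exact: measurableT_comp (measurable_tail _ _) (measurable_eudist_tuple _).
have tail0 z : (0 <= tail n.+1 rho (eudist (x N) z))%R by rewrite tail_ge0// ltW.
exists (D `|` E), (fun z => H z + c * tail n.+1 rho (eudist (x N) z))%R; split.
- split => //; rewrite big_ord_recr/= mulrDl EFinD -muE.
  by apply: le_trans (measureU2 _ mD mE) _; rewrite leeD.
- by apply: measurable_funD => //; exact: measurable_funM.
- by move=> z; rewrite addr_ge0// mulr_ge0.
- under eq_integral do rewrite EFinD EFinM.
  rewrite ge0_integralD//; last 4 first.
  + by move=> z _; rewrite lee_fin.
  + exact/measurable_EFinP.
  + by move=> z _; rewrite -EFinM lee_fin mulr_ge0.
  + by apply: emeasurable_funM => //; exact/measurable_EFinP.
  rewrite big_ord_recr/= mulrDr EFinD leeD//.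
  rewrite ge0_integralZl_EFin//; last 2 first.
  + by move=> z _; rewrite lee_fin.
  + exact/measurable_EFinP.
  apply: (@le_trans _ _ (c%:E * (2 ^+ n.+2 * ball_volume n.+1)%:E)).
    by rewrite lee_wpmul2l ?lee_fin// integral_tail_le.
  by rewrite -EFinM lee_fin /dirac_cst /c; rewrite le_eqVlt; apply/orP; left; apply/eqP; ring.
- move=> k z ck DEz; have Dz : ~ D z by move=> h; apply: DEz; left.
  have [mk k0 _ _ _] := ck.
  have rhoz : (rho <= eudist (x N) z)%R.
    by rewrite leNgt; apply/negP => h; apply: DEz; right.
  rewrite big_ord_recr/= EFinD.
  have h1 := point_mass_le A0 lam0 aN0 rho0 ck mE (@subDsetl _ _ _) muE rhoz.
  apply: le_trans (leeD (DH _ _ ck Dz) h1) _.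
  rewrite ge0_integral_setU//; last 3 first.
  + exact: measurable_funTS (measurable_cz_kernel z ck).
  + by move=> y _; rewrite lee_fin.
  + by rewrite /E disj_set2E setDIK.
  have I0 (F : set (n.+1.-tuple T)) : 0 <= \int[mu n.+1]_(y in F) (k (eudist z y))%:E.
    by apply: integral_ge0 => y _; rewrite lee_fin.
  rewrite (ge0_muleDr _ (I0 _) (I0 _)).
  by rewrite EFinD addeACA.
Qed.

End point_masses.

(** * Lebesgue measurable sets and outer measure *)

Section lebesgue_borel.
Context {R : realType}.
Local Notation T := (measurableTypeR R).
Local Notation mu n := (borel_lebesgue R n).
Local Open Scope ereal_scope.

Lemma measurable_Rn n (A : set (n.-tuple T)) :
  measurable A -> measurable (A : set (Rn R n)).
Proof.
move=> mA; apply: (@sub_caratheodory _ _ _ (mu n) A).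
exact: sub_sigma_algebra.
Qed.

Lemma lebesgueE n (A : set (n.-tuple T)) :
  measurable A -> @lebesgue R n A = mu n A.
Proof. by move=> mA; exact: measurable_mu_extE. Qed.

Lemma le_lebesgue n (A B : set (Rn R n)) :
  A `<=` B -> @lebesgue R n A <= @lebesgue R n B.
Proof. by move=> AB; exact: (@le_mu_ext _ _ _ (mu n) A B AB). Qed.

(** The sets S i may fail to be measurable; as they increase, each of them lies
    in the limit inferior of the G i, to which continuity from below
    applies. *)
Lemma bigcup_nondecreasing_cover d (X : measurableType d)
    (m : {measure set X -> \bar R}) (S G : nat -> set X) (c : \bar R) :
  {homo S : i j / (i <= j)%N >-> i `<=` j} ->
  (forall i, [/\ measurable (G i), m (G i) <= c & S i `<=` G i]) ->
  exists G', [/\ measurable G', m G' <= c & \bigcup_i S i `<=` G'].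
Proof.
move=> ndS SG.
pose F (j : nat) := \bigcap_(i in [set i | (j <= i)%N]) G i.
have mF j : measurable (F j).
  by apply: bigcap_measurableType => i _; have [] := SG i.
have mUF : measurable (\bigcup_j F j) by exact: bigcupT_measurable.
have ndF : {homo F : i j / (i <= j)%N >-> (i <= j)%O}.
  move=> i j ij; apply/subsetPset => x Fx k /= jk; apply: Fx => /=.
  exact: leq_trans jk.
exists (\bigcup_j F j); split => //.
  have cF := @nondecreasing_cvg_mu _ _ _ m _ mF mUF ndF.
  rewrite -(cvg_lim _ cF)//; apply: lime_le; first by apply/cvg_ex; eexists; exact: cF.
  apply: nearW => j /=; have [mGj Gjc _] := SG j.
  by apply: le_trans Gjc; apply: le_measure; rewrite ?inE// => x; apply => /=.
move=> x [i _ Six]; exists i => // j /= ij.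
by have [_ _] := SG j; apply; exact: ndS Six.
Qed.

End lebesgue_borel.

(** * A countable partition into small pieces *)

Section small_pieces.
Context {R : realType}.
Local Notation T := (measurableTypeR R).

Definition rat_point n (i : nat) : n.-tuple T :=
  if unpickle i is Some v then [tuple ratr (tnth (v : n.-tuple rat) j) | j < n]
  else origin.

Lemma rat_point_dense n (z : n.-tuple T) (e : R) : 0 < e ->
  exists i, eudist (rat_point n i) z < e.
Proof.
move=> e0; pose d := e / (n%:R + 1).
have n1 : 0 < n%:R + 1 :> R by rewrite ltr_wpDl.
have d0 : 0 < d by rewrite divr_gt0.
have qP j : exists q : rat, `|ratr q - tnth z j| < d.
  have [|q] := @rat_in_itvoo R (tnth z j - d) (tnth z j + d); first by lra.
  by rewrite in_itv/= => qd; exists q; rewrite ltr_norml; lra.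
pose q (j : 'I_n) : rat := projT1 (cid (qP j)).
exists (pickle [tuple q j | j < n]).
apply: (@le_lt_trans _ _ (n%:R * d)).
  apply: eudist_le => j; rewrite /rat_point pickleK !tnth_mktuple.
  exact/ltW/(projT2 (cid (qP j))).
by rewrite /d mulrCA gtr_pMr// ltr_pdivrMr// mul1r ltrDl.
Qed.

Definition piece n (e : R) : nat -> set (n.-tuple T) :=
  seqDU (fun i => eball (rat_point n i) e).

Arguments piece : clear implicits.

Lemma measurable_piece n e i : measurable (piece n e i).
Proof.
by apply: measurableD; [|apply: bigsetU_measurable => j _]; exact: measurable_eball.
Qed.

Lemma piece_subset n e i : piece n e i `<=` eball (rat_point n i) e.
Proof. exact: subset_seqDU. Qed.

Lemma trivIset_piece n e : trivIset setT (piece n e).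
Proof. exact: trivIset_seqDU. Qed.

Lemma bigcup_piece n e : 0 < e -> \bigcup_i piece n e i = setT.
Proof.
move=> e0; rewrite -(@seqDU_bigcup_eq _ (fun i => eball (rat_point n i) e)).
rewrite -subTset => z _; have [i ie] := rat_point_dense z e0.
by exists i.
Qed.

End small_pieces.
Arguments piece {R} n e _.

(** * From point masses to functions *)

Section from_point_masses_to_functions.
Context {R : realType}.
Local Notation T := (measurableTypeR R).
Local Notation mu n := (borel_lebesgue R n).
Local Open Scope ereal_scope.

Lemma dirac_cst_ge0 n (A : R) : (0 <= A)%R -> (0 <= dirac_cst n A)%R.
Proof.
move=> A0; rewrite /dirac_cst; apply: mulr_ge0.
  by apply: mulr_ge0 => //; exact: exprn_ge0.
by apply: mulr_ge0; [exact: exprn_ge0|exact: ball_volume_ge0].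
Qed.

Lemma markov_measure_le d (X : measurableType d) (m : {measure set X -> \bar R})
    (H : X -> R) (lam c : R) : (0 < lam)%R ->
  measurable_fun [set: X] H -> (forall x, 0 <= H x)%R ->
  \int[m]_x (H x)%:E <= c%:E -> m [set x | (lam <= H x)%R] <= (c / lam)%:E.
Proof.
move=> lam0 mH H0 Hc.
have -> : [set x | (lam <= H x)%R] = setT `&` [set x | lam%:E <= `|(EFin \o H) x| ].
  by rewrite setTI; apply/seteqP; split => x /=; rewrite lee_fin ger0_norm.
have := @le_integral_comp_abse _ _ _ m _ measurableT (EFin \o H) lam id
  (@measurable_id _ _ _) (fun r r0 => r0).
move=> /(_ _ _ lam0) h.
have {}h : lam%:E * m (setT `&` [set x | lam%:E <= `|(EFin \o H) x| ]) <= c%:E.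
  apply: le_trans (h _ _) _.
  - by move=> x y _ _.
  - exact/measurable_EFinP.
  apply: le_trans Hc; rewrite le_eqVlt; apply/orP; left; apply/eqP.
  by apply: eq_integral => x _ /=; rewrite ger0_norm.
by rewrite EFinM lee_pdivlMr// muleC.
Qed.

(** Off D and off the set where the error H exceeds lam, the sum is at most
    A * lam + lam. *)
Lemma dirac_weak_set n (A lam : R) (x : nat -> n.+1.-tuple T) (a : nat -> R) N :
  (0 <= A)%R -> (0 < lam)%R -> (forall i, 0 <= a i)%R ->
  exists G : set (n.+1.-tuple T),
  [/\ measurable G,
      mu n.+1 G <= ((1 + dirac_cst n A) * (\sum_(i < N) a i) / lam)%:E &
      forall k z, cz_kernel n.+1 A k -> ~ G z ->
       (\sum_(i < N) a i * k (eudist z (x i)) <= (A + 1) * lam)%R].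
Proof.
move=> A0 lam0 a0.
have [D [H [[mD muD] mH H0 intH DH]]] := dirac_weak x N A0 lam0 a0.
pose M := [set z | (lam <= H z)%R].
have mM : measurable M.
  rewrite /M -[X in measurable X]setTI.
  apply: (measurable_fun_ler (f := cst lam) (g := H)) => //.
exists (D `|` M); split; first exact: measurableU.
  apply: le_trans (measureU2 _ mD mM) _.
  rewrite -mulrA mulrDl mul1r EFinD leeD// mulrA.
  exact: markov_measure_le.
move=> k z ck DMz.
have Dz : ~ D z by move=> h; apply: DMz; left.
have Hz : (H z < lam)%R by rewrite ltNge; apply/negP => h; apply: DMz; right.
have [mk k0 _ _ kA] := ck.
have kz0 y : 0 <= (k (eudist z y))%:E by rewrite lee_fin.
have DA : \int[mu n.+1]_(y in D) (k (eudist z y))%:E <= A%:E.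
  apply: (@le_trans _ _ (\int[mu n.+1]_y (k (eudist z y))%:E)).
    apply: ge0_subset_integral => //.
    exact: measurable_cz_kernel ck.
  rewrite (ge0_integral_radial_shift z (g := EFin \o k))//.
    exact/measurable_EFinP.
rewrite -lee_fin; apply: (le_trans (DH _ _ ck Dz)).
rewrite mulrDl mul1r EFinD leeD//; last by rewrite lee_fin ltW.
by rewrite mulrC EFinM lee_wpmul2l// lee_fin ltW.
Qed.

(** The mass distribution h dm lives on a measure space X and is seen in R^n
    through a point map p.  For the maximal operator, X is R^n with its
    Lebesgue measurable sets, p is the identity, and the exceptional sets are
    found among the Borel sets of the target. *)
Context {d} {X : measurableType d} (m : {measure set X -> \bar R}).
Context {n : nat} (p : X -> n.+1.-tuple T).
Hypothesis mp : measurable_fun [set: X] p.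

Lemma measurable_radial_comp (z : n.+1.-tuple T) (k : R -> R) :
  measurable_fun [set: R] k ->
  measurable_fun [set: X] (fun y => k (eudist z (p y))).
Proof.
move=> mk; apply: measurableT_comp mk _.
exact: measurableT_comp (measurable_eudist_tuple z) mp.
Qed.

Lemma integral_mul_le (P : set X) (w h : X -> R) (c : R) :
  measurable P -> measurable_fun [set: X] w -> measurable_fun [set: X] h ->
  (forall y, 0 <= w y)%R -> (forall y, 0 <= h y)%R -> (0 <= c)%R ->
  (forall y, P y -> w y <= c)%R ->
  \int[m]_(y in P) (w y * h y)%:E <= c%:E * \int[m]_(y in P) (h y)%:E.
Proof.
move=> mP mw mh w0 h0 c0 wc.
rewrite -ge0_integralZl_EFin//; last 2 first.
- by move=> y _; rewrite lee_fin.
- by apply/measurable_EFinP; exact: measurable_funTS.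
apply: ge0_le_integral => //.
- by move=> y _; rewrite lee_fin mulr_ge0.
- apply/measurable_EFinP; apply: measurable_funTS; exact: measurable_funM.
- apply/measurable_EFinP; apply: measurable_funTS; exact: measurable_funM.
- by move=> y Py; rewrite -EFinM lee_fin ler_wpM2r// wc.
Qed.

Lemma integral_piece_le (h : X -> R) (k : R -> R) (e L : R) z i :
  measurable_fun [set: X] h -> (forall y, 0 <= h y)%R ->
  measurable_fun [set: R] k -> (forall r, 0 <= k r)%R -> (0 <= L)%R -> (0 <= e)%R ->
  (forall r s, 0 <= r -> 0 <= s -> `|k r - k s| <= L * `|r - s|)%R ->
  \int[m]_(y in p @^-1` piece n.+1 e i) (k (eudist z (p y)) * h y)%:E <=
  (k (eudist z (rat_point n.+1 i)) + L * e)%:E *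
    \int[m]_(y in p @^-1` piece n.+1 e i) (h y)%:E.
Proof.
move=> mh h0 mk k0 L0 e0 Lk; apply: integral_mul_le => //.
- by rewrite -[X in measurable X]setTI; apply: mp => //; exact: measurable_piece.
- exact: measurable_radial_comp.
- by rewrite addr_ge0// mulr_ge0.
move=> y /= /piece_subset; rewrite /eball/= => ye.
have := Lk _ _ (eudist_ge0 z (p y)) (eudist_ge0 z (rat_point n.+1 i)).
have := eudist_triangle z (rat_point n.+1 i) (p y).
have := eudist_triangle z (p y) (rat_point n.+1 i).
rewrite (eudistC (p y)) => t1 t2 kd.
have := ler_norm (k (eudist z (p y)) - k (eudist z (rat_point n.+1 i)))%R.
have : (`|eudist z (p y) - eudist z (rat_point n.+1 i)| <= e)%R.
  by rewrite ler_norml; apply/andP; split; lra.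
move=> /(ler_wpM2l L0); lra.
Qed.

(** Each piece is replaced by a mass at its centre; with pieces of radius e the
    errors add up to at most L * e * F, which the choice of e makes smaller than
    lam.  The bound for the first N pieces holds off a set of controlled
    measure, and the sets where the partial sums are too large increase
    with N. *)
Lemma lipschitz_weak (A L lam F : R) (h : X -> R) :
  (0 <= A)%R -> (0 <= L)%R -> (0 < lam)%R -> (0 <= F)%R ->
  measurable_fun [set: X] h -> (forall y, 0 <= h y)%R ->
  \int[m]_y (h y)%:E <= F%:E ->
  exists G : set (n.+1.-tuple T),
  [/\ measurable G, mu n.+1 G <= ((1 + dirac_cst n A) * F / lam)%:E &
      forall k z, cz_kernel n.+1 A k ->
        (forall r s, 0 <= r -> 0 <= s -> `|k r - k s| <= L * `|r - s|)%R ->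
        ~ G z ->
        \int[m]_y (k (eudist z (p y)) * h y)%:E <= ((A + 2) * lam)%:E].
Proof.
move=> A0 L0 lam0 F0 mh h0 hF.
pose e := (lam / (L * F + 1))%R.
have LF1 : (0 < L * F + 1)%R by rewrite ltr_wpDl// mulr_ge0.
have e0 : (0 < e)%R by rewrite divr_gt0.
have LeF : (L * e * F <= lam)%R.
  by rewrite /e mulrAC mulrA ler_pdivrMr// mulrC ler_pM2l// lerDl.
pose P i : set X := p @^-1` piece n.+1 e i.
have mP i : measurable (P i) 
  by rewrite -[X in measurable X]setTI; apply: mp => //; exact: measurable_piece.
have UP : \bigcup_i P i = setT by rewrite -preimage_bigcup bigcup_piece.
have tP : trivIset setT P.
  move=> i j _ _ [y [yi yj]]; apply: (trivIset_piece (n := n.+1) (e := e)) => //.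
  by exists (p y).
pose a' i := \int[m]_(y in P i) (h y)%:E.
have a'0 i : 0 <= a' i by apply: integral_ge0 => y _; rewrite lee_fin.
have hE y : 0 <= (h y)%:E by rewrite lee_fin.
have mhE : measurable_fun [set: X] (EFin \o h) by exact/measurable_EFinP.
have a'sum N : \sum_(i < N) a' i <= F%:E.
  apply: le_trans hF; rewrite -UP (ge0_integral_bigcup m mP)//; last first.
    by rewrite UP.
  rewrite -(big_mkord xpredT a'); apply: nneseries_lim_ge => i _ _; exact: a'0.
pose a i := fine (a' i).
have a'E i : a' i = (a i)%:E.
  rewrite fineK// ge0_fin_numE//; apply: le_lt_trans (ltry F).
  apply: le_trans (a'sum i.+1); rewrite big_ord_recr/= leeDr//.
  by apply: sume_ge0.
have a0 i : (0 <= a i)%R by rewrite -lee_fin -a'E.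
have asum N : (\sum_(i < N) a i <= F)%R.
  by rewrite -lee_fin -sumEFin; under eq_bigr do rewrite -a'E.
pose S N : set (n.+1.-tuple T) := [set z | exists k, [/\ cz_kernel n.+1 A k,
  (forall r s, 0 <= r -> 0 <= s -> `|k r - k s| <= L * `|r - s|)%R &
  ((A + 2) * lam)%:E <
    \sum_(i < N) \int[m]_(y in P i) (k (eudist z (p y)) * h y)%:E]].
have kh0 k z i : cz_kernel n.+1 A k ->
    0 <= \int[m]_(y in P i) (k (eudist z (p y)) * h y)%:E.
  by move=> [_ k0 _ _ _]; apply: integral_ge0 => y _; rewrite lee_fin mulr_ge0.
have ndS : {homo S : i j / (i <= j)%N >-> i `<=` j}.
  move=> i j ij z [k [ck Lk kz]]; exists k; split => //.
  apply: (lt_le_trans kz).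
  set f := fun i : nat => \int[m]_(y in P i) (k (eudist z (p y)) * h y)%:E.
  rewrite -(big_mkord xpredT f) -[leRHS](big_mkord xpredT f).
  by apply: lee_sum_nneg_natr => // l _ _; exact: kh0.
have SG N : exists G : set (n.+1.-tuple T),
    [/\ measurable G, mu n.+1 G <= ((1 + dirac_cst n A) * F / lam)%:E & S N `<=` G].
  have [G [mG muG GA]] := dirac_weak_set (rat_point n.+1) N A0 lam0 a0.
  exists G; split => //.
    apply: (le_trans muG); rewrite lee_fin ler_wpM2r ?invr_ge0 ?(ltW lam0)//.
    by rewrite ler_wpM2l// addr_ge0// dirac_cst_ge0.
  move=> z [k [ck Lk kz]]; apply: contrapT => Gz; move: kz; apply/negP.
  rewrite -leNgt; have [mk k0 _ _ _] := ck.
  apply: (@le_trans _ _ (\sum_(i < N)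
      (a i * k (eudist z (rat_point n.+1 i)) + L * e * a i)%:E)).
    apply: lee_sum => i _.
    apply: (le_trans (@integral_piece_le h k e L z i mh h0 mk k0 L0 (ltW e0) Lk)).
    by rewrite -/(a' i) a'E -EFinM lee_fin mulrDl mulrC.
  rewrite sumEFin lee_fin big_split/= -mulr_sumr.
  have := GA _ _ ck Gz.
  have : (L * e * \sum_(i < N) a i <= L * e * F)%R.
    by rewrite ler_wpM2l// mulr_ge0// ltW.
  lra.
have [G PG] := choice SG.
have [G' [mG' muG' SG']] := bigcup_nondecreasing_cover ndS PG.
exists G'; split => // k z ck Lk Gz.
have [mk k0 _ _ _] := ck.
rewrite -UP (ge0_integral_bigcup m mP)//; last 2 first.
- rewrite UP; apply/measurable_EFinP; apply: measurable_funM => //.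
  exact: measurable_radial_comp.
- by move=> y _; rewrite lee_fin mulr_ge0.
apply: lime_le; first by apply: is_cvg_nneseries => i _ _; exact: kh0.
apply: nearW => N; rewrite leNgt; apply/negP => kz.
apply: Gz; apply: SG'; exists N => //; exists k; split => //.
by move: kz; rewrite big_mkord.
Qed.

End from_point_masses_to_functions.

(** * Truncation near the origin *)

Section truncation.
Context {R : realType}.
Local Notation T := (measurableTypeR R).
Local Notation mu n := (borel_lebesgue R n).

(** This ramp vanishes up to eta, lies above the size bound A / r ^+ n beyond
    2 * eta, and its slope A / eta ^+ n.+1 is comparable to the Lipschitz bound
    of the class up to 2 * eta.  The minimum of a kernel with it is therefore
    still in the class, equals the kernel beyond 2 * eta, and is globally
    Lipschitz. *)
Definition cutoff (n : nat) (A eta r : R) : R := A / eta ^+ n.+1 * Num.max 0 (r - eta).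

Definition truncate (n : nat) (A eta : R) (k : R -> R) (r : R) : R :=
  Num.min (k r) (cutoff n A eta r).

Lemma dist_min_le (a b c d e : R) : `|a - c| <= e -> `|b - d| <= e ->
  `|Num.min a b - Num.min c d| <= e.
Proof.
rewrite !ler_norml => /andP[h1 h2] /andP[h3 h4].
by rewrite /Num.min; case: ltP => ab; case: ltP => cd; apply/andP; split; lra.
Qed.

Lemma dist_max0_le (a b : R) : `|Num.max 0 a - Num.max 0 b| <= `|a - b|.
Proof.
by rewrite /Num.max; case: ltP => a0; case: ltP => b0;
  rewrite ler_norml; have := ler_norm (a - b); have := ler_norm (b - a);
  rewrite (distrC b) => h1 h2; apply/andP; split; lra.
Qed.

Lemma cutoff_ge0 n A eta r : 0 <= A -> 0 < eta -> 0 <= cutoff n A eta r.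
Proof.
move=> A0 eta0; rewrite /cutoff mulr_ge0 ?le_max ?lexx//.
by rewrite divr_ge0// exprn_ge0// ltW.
Qed.

Lemma cutoff_lipschitz n A eta r s : 0 <= A -> 0 < eta ->
  `|cutoff n A eta r - cutoff n A eta s| <= A / eta ^+ n.+1 * `|r - s|.
Proof.
move=> A0 eta0; rewrite /cutoff -mulrBr normrM.
have c0 : 0 <= A / eta ^+ n.+1 by rewrite divr_ge0// exprn_ge0// ltW.
rewrite (ger0_norm c0) ler_wpM2l//.
apply: le_trans (dist_max0_le _ _) _.
by rewrite (_ : r - eta - (s - eta) = r - s)//; ring.
Qed.

Lemma truncate_id n A eta k r : cz_kernel n A k -> 0 <= A -> 0 < eta ->
  2 * eta <= r -> truncate n A eta k r = k r.
Proof.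
move=> [_ _ kA _ _] A0 eta0 r2; rewrite /truncate; apply/min_idPl.
have r0 : 0 < r by lra.
have := kA _ r0; rewrite -ler_pdivlMr ?exprn_gt0// => /le_trans; apply.
apply: (@le_trans _ _ (A / eta ^+ n)).
  rewrite ler_wpM2l// lef_pV2 ?posrE ?exprn_gt0// lerXn2r ?nnegrE ?ltW//; lra.
rewrite /cutoff.
have -> : A / eta ^+ n = A / eta ^+ n.+1 * eta.
  by rewrite exprS; field; rewrite expf_neq0 ?gt_eqF.
rewrite ler_wpM2l ?divr_ge0 ?exprn_ge0 ?(ltW eta0)//.
by rewrite le_max; apply/orP; right; lra.
Qed.

Lemma truncate0 n A eta k r : (forall r, 0 <= k r) -> r <= eta ->
  truncate n A eta k r = 0.
Proof.
move=> k0 reta; rewrite /truncate /cutoff.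
have -> : Num.max 0 (r - eta) = 0 by apply/max_idPl; rewrite subr_le0.
by rewrite mulr0; apply/min_idPr.
Qed.

Lemma truncate_ge0 n A eta k r : (forall r, 0 <= k r) -> 0 <= A -> 0 < eta ->
  0 <= truncate n A eta k r.
Proof. by move=> k0 A0 eta0; rewrite /truncate le_min k0 cutoff_ge0. Qed.

Lemma truncate_le n A eta k r : truncate n A eta k r <= k r.
Proof. by rewrite /truncate ge_min lexx. Qed.

Lemma truncate_homo n A eta eta' k r : 0 <= A -> 0 < eta -> eta <= eta' ->
  truncate n A eta' k r <= truncate n A eta k r.
Proof.
move=> A0 eta0 ee; have eta'0 : 0 < eta' by exact: lt_le_trans ee.
rewrite /truncate le_min ge_min lexx/= ge_min; apply/orP; right.
rewrite /cutoff ler_pM ?divr_ge0 ?exprn_ge0 ?(ltW eta'0)//.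
- by rewrite le_max lexx.
- by rewrite ler_wpM2l// lef_pV2 ?posrE ?exprn_gt0// lerXn2r ?nnegrE ?(ltW eta0) ?(ltW eta'0).
- by rewrite ge_max !le_max lexx/=; apply/orP; right; lra.
Qed.

Lemma measurable_truncate n A eta k : measurable_fun [set: R] k ->
  measurable_fun [set: R] (truncate n A eta k).
Proof.
move=> mk; apply: measurable_minr => //.
apply: measurable_funM => //; apply: measurable_maxr => //.
exact: measurable_funB.
Qed.

Lemma truncate_lipschitz n A eta k r s : cz_kernel n A k -> 0 <= A -> 0 < eta ->
  0 <= r -> 0 <= s ->
  `|truncate n A eta k r - truncate n A eta k s| <= A / eta ^+ n.+1 * `|r - s|.
Proof.
move=> ck A0 eta0; wlog rs : r s / r <= s.
  move=> h r0 s0; have [rs|/ltW sr] := leP r s; first exact: h.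
  by rewrite distrC (distrC r); exact: h.
move=> r0 s0; have [_ k0 _ lipk _] := ck.
have [reta|etar] := ltP r eta.
  rewrite truncate0// ?(ltW reta)// sub0r normrN ger0_norm ?truncate_ge0//.
  apply: (@le_trans _ _ (cutoff n A eta s)); first by rewrite /truncate ge_min lexx orbT.
  apply: (le_trans _ (cutoff_lipschitz n r s A0 eta0)).
  have -> : cutoff n A eta r = 0.
    by rewrite /cutoff (_ : Num.max _ _ = 0) ?mulr0//; apply/max_idPl; lra.
  by rewrite sub0r normrN ler_norm.
apply: dist_min_le; last exact: cutoff_lipschitz.
have r0' : 0 < r by exact: lt_le_trans etar.
have := lipk _ _ r0' rs; rewrite -ler_pdivlMr ?exprn_gt0// => /le_trans; apply.
rewrite distrC (ger0_norm (_ : 0 <= s - r)) ?subr_ge0// mulrAC.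
rewrite ler_wpM2r ?subr_ge0// ler_wpM2l// lef_pV2 ?posrE ?exprn_gt0//.
by rewrite lerXn2r ?nnegrE ?(ltW eta0).
Qed.

Lemma cz_kernel_truncate n A eta k : cz_kernel n A k -> 0 <= A -> 0 < eta ->
  cz_kernel n (2 ^+ n.+1 * A) (truncate n A eta k).
Proof.
move=> ck A0 eta0; have [mk k0 kA lipk intk] := ck.
have A2 : A <= 2 ^+ n.+1 * A by rewrite ler_peMl// exprn_ege1//; lra.
split.
- exact: measurable_truncate.
- by move=> r; exact: truncate_ge0.
- move=> r r0; apply: le_trans A2; apply: le_trans (kA r r0).
  by rewrite ler_wpM2r ?truncate_le// exprn_ge0// ltW.
- move=> r s r0 rs; have s0 : 0 < s by exact: lt_le_trans rs.
  have sr0 : 0 <= s - r by rewrite subr_ge0.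
  have [r2|/ltW r2] := leP r (2 * eta); last first.
    rewrite !truncate_id//; last by lra.
    by apply: (le_trans (lipk _ _ r0 rs)); rewrite ler_wpM2r.
  rewrite -ler_pdivlMr ?exprn_gt0//; apply: dist_min_le.
    rewrite ler_pdivlMr ?exprn_gt0//.
    by apply: (le_trans (lipk _ _ r0 rs)); rewrite ler_wpM2r.
  apply: (le_trans (cutoff_lipschitz _ _ _ A0 eta0)).
  rewrite distrC (ger0_norm sr0) [leRHS]mulrAC ler_wpM2r// [2 ^+ _ * A]mulrC -mulrA.
  rewrite ler_wpM2l// ler_pdivlMr ?exprn_gt0// mulrC ler_pdivrMr ?exprn_gt0//.
  by rewrite -exprMn lerXn2r ?nnegrE ?(ltW r0)// mulr_ge0// ltW.
- apply: (@le_trans _ _ A%:E); last by rewrite lee_fin.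
  apply: le_trans intk; apply: ge0_le_integral => //.
  + by move=> y _; rewrite lee_fin truncate_ge0.
  + apply: (measurable_radial origin (g := EFin \o truncate n A eta k)).
    by apply/measurable_EFinP; exact: measurable_truncate.
  + apply: (measurable_radial origin (g := EFin \o k)).
    exact/measurable_EFinP.
  + by move=> y _; rewrite lee_fin truncate_le.
Qed.

Local Open Scope ereal_scope.

Context {d} {X : measurableType d} (m : {measure set X -> \bar R}).
Context {n : nat} (p : X -> n.+1.-tuple T).
Hypothesis mp : measurable_fun [set: X] p.

(** The truncations increase to the kernel as eta decreases to 0, so the sets
    where the truncated averages are too large increase as well. *)
Lemma cz_weak (A lam F : R) (h : X -> R) :
  (0 <= A)%R -> (0 < lam)%R -> (0 <= F)%R ->
  measurable_fun [set: X] h -> (forall y, 0 <= h y)%R ->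
  \int[m]_y (h y)%:E <= F%:E ->
  exists G : set (n.+1.-tuple T),
  [/\ measurable G,
      mu n.+1 G <= ((1 + dirac_cst n (2 ^+ n.+2 * A)) * F / lam)%:E &
      forall k z, cz_kernel n.+1 A k -> k 0%R = 0%R -> ~ G z ->
        \int[m]_y (k (eudist z (p y)) * h y)%:E <=
        ((2 ^+ n.+2 * A + 2) * lam)%:E].
Proof.
move=> A0 lam0 F0 mh h0 hF.
set A' := (2 ^+ n.+2 * A)%R; have A'0 : (0 <= A')%R by rewrite mulr_ge0// exprn_ge0.
pose eta (j : nat) : R := (j.+1%:R^-1)%R.
have eta0 j : (0 < eta j)%R by rewrite invr_gt0.
have eta_homo i j : (i <= j)%N -> (eta j <= eta i)%R.
  by move=> ij; rewrite lef_pV2 ?posrE// ler_nat.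
pose g (k : R -> R) (z : n.+1.-tuple T) (j : nat) (y : X) : \bar R :=
  (truncate n.+1 A (eta j) k (eudist z (p y)) * h y)%:E.
have g0 k z j y : cz_kernel n.+1 A k -> 0 <= g k z j y.
  by move=> [_ k0 _ _ _]; rewrite lee_fin mulr_ge0// truncate_ge0.
have mg k z j : cz_kernel n.+1 A k -> measurable_fun [set: X] (g k z j).
  move=> [mk _ _ _ _]; apply/measurable_EFinP; apply: measurable_funM => //.
  exact: (measurable_radial_comp mp z (measurable_truncate _ _ _ mk)).
have ndg k z y : {homo (fun j => g k z j y) : i j / (i <= j)%N >-> i <= j}.
  by move=> i j ij; rewrite lee_fin ler_wpM2r// truncate_homo// eta_homo.
pose S (j : nat) : set (n.+1.-tuple T) := [set z | exists k, cz_kernel n.+1 A k /\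
  ((A' + 2) * lam)%:E < \int[m]_y g k z j y].
have ndS : {homo S : i j / (i <= j)%N >-> i `<=` j}.
  move=> i j ij z [k [ck kz]]; exists k; split => //.
  apply: (lt_le_trans kz); apply: ge0_le_integral => //.
  - by move=> y _; exact: g0.
  - exact: mg.
  - exact: mg.
  - by move=> y _; exact: ndg.
have SG j : exists G : set (n.+1.-tuple T), [/\ measurable G,
    mu n.+1 G <= ((1 + dirac_cst n A') * F / lam)%:E & S j `<=` G].
  have L0 : (0 <= A / eta j ^+ n.+2)%R by rewrite divr_ge0// exprn_ge0// ltW.
  have [G [mG muG GA]] := lipschitz_weak mp A'0 L0 lam0 F0 mh h0 hF.
  exists G; split => // z [k [ck kz]]; apply: contrapT => Gz; move: kz; apply/negP.
  rewrite -leNgt; apply: (GA _ z) => //; first exact: cz_kernel_truncate.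
  by move=> r s r0 s0; exact: truncate_lipschitz.
have [G PG] := choice SG.
have [G' [mG' muG' SG']] := bigcup_nondecreasing_cover ndS PG.
exists G'; split => // k z ck k00 Gz.
have [mk k0 _ _ _] := ck.
have -> : \int[m]_y (k (eudist z (p y)) * h y)%:E =
    \int[m]_y limn (fun j => g k z j y).
  apply: eq_integral => y _; apply/esym; apply: lim_near_cst => //.
  have := eudist_ge0 z (p y); rewrite le_eqVlt => /predU1P[r0|r0].
    by apply: nearW => j; rewrite /g -r0 truncate0 ?k00 ?(ltW (eta0 j)).
  exists (Num.truncn (2 / eudist z (p y))%R) => // j /= hj.
  rewrite /g (truncate_id ck)//.
  have jr : (2 / eudist z (p y) < j.+1%:R)%R.
    by apply: lt_le_trans (truncnS_gt _) _; rewrite ler_nat.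
  rewrite /eta ler_pdivrMr// mulrC.
  by move: jr; rewrite ltr_pdivrMr// => /ltW.
rewrite (monotone_convergence m measurableT (fun j => mg k z j ck)
  (fun j y _ => g0 k z j y ck) (fun y _ => ndg k z y)).
apply: lime_le.
  apply: ereal_nondecreasing_is_cvgn => i j ij; apply: ge0_le_integral => //.
  - by move=> y _; exact: g0.
  - exact: mg.
  - exact: mg.
  - by move=> y _; exact: ndg.
apply: nearW => j; rewrite leNgt; apply/negP => kz.
by apply: Gz; apply: SG'; exists j => //; exists k.
Qed.

End truncation.

(** * Dilates of the profile *)

Section dilated_profile.
Context {R : realType} (n : nat) (phi : R -> R) (B : R).
Local Notation T := (measurableTypeR R).
Local Notation mu n := (borel_lebesgue R n).
Hypothesis phi_ge0 : forall r : R, 0 < r -> 0 <= phi r.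
Hypothesis phi_derivable : forall r : R, 0 < r -> derivable phi r 1.
Hypothesis phi_int : (\int[@lebesgue_measure R]_(r in `]0%R, +oo[)
                (r ^+ n * phi r)%:E < +oo)%E.
Hypothesis phi_drv : forall r : R, 0 < r -> `|derive1 phi r| <= B / r ^+ n.+2.

Let phi_continuous (r : R) : 0 < r -> {for r, continuous phi}.
Proof.
move=> r0; apply: differentiable_continuous.
by apply/derivable1_diffP; exact: phi_derivable.
Qed.

(** Values of phi off the half-line are arbitrary. *)
Definition phi_pos (r : R) : R := if 0 < r then phi r else 0.

Lemma measurable_phi_pos : measurable_fun [set: R] phi_pos.
Proof. by apply: measurable_fun_pos_continuous => r; exact: phi_continuous. Qed.

Lemma phi_pos_ge0 r : 0 <= phi_pos r.
Proof. by rewrite /phi_pos; case: ifPn => // /phi_ge0. Qed.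

Lemma phi_posE r : 0 < r -> phi_pos r = phi r.
Proof. by rewrite /phi_pos => ->. Qed.

Lemma drv_cst_ge0 : 0 <= B.
Proof.
have := phi_drv ltr01; rewrite expr1n divr1; exact: le_trans.
Qed.

Lemma phi_lipschitz r s : 0 < r -> r <= s ->
  `|phi r - phi s| * r ^+ n.+2 <= B * (s - r).
Proof.
move=> r0 rs; have sr0 : 0 <= s - r by rewrite subr_ge0.
have [||c] := @MVT_segment R phi (derive1 phi) r s rs.
- move=> x; rewrite in_itv/= => /andP[rx _].
  have x0 : 0 < x by exact: lt_trans rx.
  by rewrite derive1E; apply: derivableP; exact: phi_derivable.
- apply: continuous_in_subspaceT => x; rewrite inE/= in_itv/= => /andP[rx _].
  by apply: phi_continuous; exact: lt_le_trans rx.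
rewrite in_itv/= => /andP[rc _] phiE.
have c0 : 0 < c by exact: lt_le_trans rc.
rewrite distrC phiE normrM (ger0_norm sr0) mulrAC ler_wpM2r//.
rewrite -ler_pdivlMr ?exprn_gt0//; apply: (le_trans (phi_drv c0)).
rewrite ler_wpM2l ?drv_cst_ge0// lef_pV2 ?posrE ?exprn_gt0//.
by rewrite lerXn2r ?nnegrE ?(ltW r0) ?(ltW c0).
Qed.

Definition phi_mass : R :=
  fine (\int[@lebesgue_measure R]_(r in `]0%R, +oo[) (r ^+ n * phi_pos r)%:E).

Lemma phi_massE :
  (\int[@lebesgue_measure R]_(r in `]0%R, +oo[) (r ^+ n * phi_pos r)%:E)%E = phi_mass%:E.
Proof.
rewrite fineK// ge0_fin_numE; last first.
  apply: integral_ge0 => r /=; rewrite in_itv/= andbT => r0.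
  by rewrite lee_fin mulr_ge0 ?phi_pos_ge0// exprn_ge0// ltW.
apply: le_lt_trans phi_int; rewrite le_eqVlt; apply/orP; left; apply/eqP.
apply: eq_integral => r.
by rewrite inE/= in_itv/= andbT => r0; rewrite phi_posE.
Qed.

Lemma phi_mass_ge0 : 0 <= phi_mass.
Proof.
rewrite -lee_fin -phi_massE; apply: integral_ge0 => r /=.
rewrite in_itv/= andbT => r0.
by rewrite lee_fin mulr_ge0 ?phi_pos_ge0// exprn_ge0// ltW.
Qed.

(** If phi r * r ^+ n.+1 exceeds B, then the Lipschitz bound keeps phi above
    phi r - B / r ^+ n.+1 on ]r, 2 * r], and the integral over this interval is
    at least phi r * r ^+ n.+1 - B. *)
Lemma phi_growth r : 0 < r -> phi r * r ^+ n.+1 <= B + phi_mass.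
Proof.
move=> r0; have [/le_trans->//|rB] := leP (phi r * r ^+ n.+1) B.
  by rewrite lerDl phi_mass_ge0.
pose c := r ^+ n * (phi r - B / r ^+ n.+1).
have c1 : 0 <= phi r - B / r ^+ n.+1.
  by rewrite subr_ge0 ler_pdivrMr ?exprn_gt0// ltW.
have c0 : 0 <= c by rewrite mulr_ge0// exprn_ge0// ltW.
have -> : phi r * r ^+ n.+1 = c * r + B.
  by rewrite /c exprS; field; rewrite expf_neq0 gt_eqF.
rewrite addrC lerD2l -lee_fin -phi_massE.
pose J : set R := [set` Interval (BRight r) (BRight (2 * r))].
have mJ : measurable J by exact: measurable_itv.
have mphi : measurable_fun [set: R] (fun s => (s ^+ n * phi_pos s)%:E).
  apply/measurable_EFinP; apply: measurable_funM; first exact: exprn_measurable.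
  exact: measurable_phi_pos.
apply: (@le_trans _ _ (\int[lebesgue_measure]_(s in J) (s ^+ n * phi_pos s)%:E)%E).
  have JE : lebesgue_measure J = r%:E.
    rewrite /J lebesgue_measure_itv/= lte_fin ifT; last by lra.
    by rewrite -EFinB; congr EFin; ring.
  rewrite EFinM -JE -integral_cst//; apply: ge0_le_integral => //.
  - exact: measurable_funTS.
  - move=> s; rewrite /J/= in_itv/= => /andP[rs s2].
    have s0 : 0 < s by exact: lt_trans rs.
    rewrite lee_fin phi_posE// /c ler_pM ?exprn_ge0 ?(ltW r0)//.
      by rewrite lerXn2r ?nnegrE ?ltW.
    have := phi_lipschitz r0 (ltW rs).
    rewrite -ler_pdivlMr ?exprn_gt0// => h.
    have : B * (s - r) / r ^+ n.+2 <= B / r ^+ n.+1.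
      rewrite [r ^+ n.+2]exprS invfM mulrA ler_wpM2r ?invr_ge0 ?exprn_ge0 ?(ltW r0)//.
      by rewrite ler_pdivrMr// ler_wpM2l ?drv_cst_ge0//; lra.
    have := ler_norm (phi r - phi s); lra.
apply: ge0_subset_integral => //.
- exact: measurable_funTS.
- move=> s /=; rewrite in_itv/= andbT => s0.
  by rewrite lee_fin mulr_ge0 ?phi_pos_ge0// exprn_ge0// ltW.
- by move=> s; rewrite /J/= !in_itv/= andbT => /andP[rs _]; exact: lt_trans rs.
Qed.

Definition dilate (e r : R) : R := (e ^+ n.+1)^-1 * phi_pos (r / e).

Definition profile_cst : R := B + phi_mass + 2 ^+ n.+2 * ball_volume n.+1 * phi_mass.

Lemma profile_cst_ge0 : 0 <= profile_cst.
Proof.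
have B0 := drv_cst_ge0; have m0 := phi_mass_ge0.
have V0 := @ball_volume_ge0 R n.+1.
apply: addr_ge0; first exact: addr_ge0.
by apply: mulr_ge0 => //; apply: mulr_ge0 => //; exact: exprn_ge0.
Qed.

(** Only powers of e appear when r is replaced by r / e, and they cancel. *)
Lemma cz_kernel_dilate e : 0 < e -> cz_kernel n.+1 profile_cst (dilate e).
Proof.
move=> e0; have e1 : e != 0 by rewrite gt_eqF.
have en0 k : e ^+ k != 0 by rewrite expf_neq0 ?gt_eqF.
have Ie0 : 0 <= (e ^+ n.+1)^-1 by rewrite invr_ge0 exprn_ge0// ltW.
have V0 : 0 <= 2 ^+ n.+2 * ball_volume n.+1 :> R.
  have V0 := @ball_volume_ge0 R n.+1.
  by apply: mulr_ge0 => //; exact: exprn_ge0.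
have m0 := phi_mass_ge0; have B0 := drv_cst_ge0.
have Vm0 : 0 <= 2 ^+ n.+2 * ball_volume n.+1 * phi_mass by exact: mulr_ge0.
have mdil : measurable_fun [set: R] (fun r => phi_pos (r / e)).
  apply: measurableT_comp measurable_phi_pos _.
  by apply: measurable_funM.
have mdilate : measurable_fun [set: R] (dilate e) by exact: measurable_funM.
have dil0 r : 0 <= dilate e r by rewrite /dilate mulr_ge0 ?phi_pos_ge0.
split => //.
- move=> r r0; have re0 : 0 < r / e by rewrite divr_gt0.
  have -> : dilate e r * r ^+ n.+1 = phi (r / e) * (r / e) ^+ n.+1.
    by rewrite /dilate phi_posE// expr_div_n; field.
  by apply: (le_trans (phi_growth re0)); rewrite /profile_cst lerDl.
- move=> r s r0 rs; have re0 : 0 < r / e by rewrite divr_gt0.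
  have s0 : 0 < s by exact: lt_le_trans rs.
  have re_se : r / e <= s / e by rewrite ler_pM2r ?invr_gt0.
  have -> : `|dilate e r - dilate e s| * r ^+ n.+2 =
      e * (`|phi (r / e) - phi (s / e)| * (r / e) ^+ n.+2).
    rewrite /dilate !phi_posE ?divr_gt0// -mulrBr normrM (ger0_norm Ie0).
    rewrite expr_div_n [e ^+ n.+2]exprS; field.
    by rewrite ?e1 ?en0.
  have := phi_lipschitz re0 re_se; rewrite -(ler_pM2l e0) => /le_trans; apply.
  have -> : e * (B * (s / e - r / e)) = B * (s - r) by field; rewrite gt_eqF.
  by rewrite ler_wpM2r ?subr_ge0// /profile_cst -addrA lerDl addr_ge0.
- apply: le_trans (ge0_integral_radial_le _ mdilate dil0 _) _.
    move=> r r0; rewrite /dilate /phi_pos pmulr_lgt0 ?invr_gt0//.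
    by rewrite ltNge r0 mulr0.
  have -> : (\int[lebesgue_measure]_(t in `]0%R, +oo[) (t ^+ n * dilate e t)%:E =
      phi_mass%:E)%E.
    have -> : (\int[lebesgue_measure]_(t in `]0%R, +oo[) (t ^+ n * dilate e t)%:E =
      ((e ^+ n.+1)^-1)%:E * \int[lebesgue_measure]_(t in `]0%R, +oo[)
         (t ^+ n * phi_pos (e^-1 * t))%:E)%E.
      rewrite -ge0_integralZl_EFin//; last 2 first.
      - move=> t /=; rewrite in_itv/= andbT => t0.
        by rewrite lee_fin mulr_ge0 ?phi_pos_ge0// exprn_ge0// ltW.
      - apply/measurable_EFinP; apply: measurable_funTS; apply: measurable_funM.
          exact: exprn_measurable.
        apply: measurableT_comp measurable_phi_pos _.
        exact: measurable_funM.
      by apply: eq_integral => t _; rewrite -EFinM /dilate mulrCA [t / e]mulrC.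
    rewrite integral_pos_dilation ?invr_gt0//; last 2 first.
    - exact: measurable_phi_pos.
    - exact: phi_pos_ge0.
    rewrite phi_massE muleA -EFinM. by rewrite exprVn invrK mulVf ?mul1r.
  by rewrite -EFinM lee_fin /profile_cst lerDr addr_ge0.
Qed.

End dilated_profile.

(** * The maximal operator *)

Section averages.
Context {R : realType}.
Local Notation T := (measurableTypeR R).
Local Open Scope ereal_scope.
Import HBNNSimple.

(** Every simple function below f is below the constant c. *)
Lemma probability_integral_le d (Omega : measurableType d)
    (P : probability Omega R) (f : Omega -> \bar R) (c : R) :
  (0 <= c)%R -> (forall w, 0 <= f w) -> (forall w, f w <= c%:E) ->
  \int[P]_w f w <= c%:E.
Proof.
move=> c0 f0 fc; rewrite ge0_integralTE//; apply: ge_ereal_sup => _ [h /= hf <-].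
rewrite -integralT_nnsfun.
apply: (@le_trans _ _ (\int[P]_w cst c%:E w)).
  apply: ge0_le_integral => //.
  - by move=> w _; rewrite lee_fin.
  - exact/measurable_EFinP.
  - by move=> w _; apply: le_trans (hf w) (fc w).
rewrite integral_cst// [X in _ * X](_ : _ = 1) ?mule1//.
exact: probability_setT.
Qed.

(** phi and phi_pos differ at most where the argument is 0, that is on the null
    set p y = z. *)
Lemma integral_dilate d (X : measurableType d) (m : {measure set X -> \bar R})
    n (p : X -> n.+1.-tuple T) (phi : R -> R) (z : n.+1.-tuple T) (e : R) (h : X -> R) :
  measurable_fun [set: X] p -> m (p @^-1` [set z]) = 0 ->
  measurable_fun [set: R] (phi_pos phi) -> measurable_fun [set: X] h ->
  (forall r, 0 <= phi_pos phi r)%R -> (forall y, 0 <= h y)%R -> (0 < e)%R ->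
  ((e ^+ n.+1)^-1)%:E * \int[m]_y (phi (eudist z (p y) / e) * h y)%:E =
  \int[m]_y (dilate n phi e (eudist z (p y)) * h y)%:E.
Proof.
move=> mp mz mphi mh phi0 h0 e0.
have mN : measurable (p @^-1` [set z]).
  by rewrite -[X in measurable X]setTI; apply: mp => //; exact: measurable_tuple1.
have mdist : measurable_fun [set: X] (fun y => eudist z (p y) / e)%R.
  apply: measurable_funM => //.
  exact: measurableT_comp (measurable_eudist_tuple z) mp.
have mG : measurable_fun [set: X] (fun y => (phi_pos phi (eudist z (p y) / e) * h y)%:E).
  apply/measurable_EFinP; apply: measurable_funM => //.
  exact: measurableT_comp mphi mdist.
have Ez : eudist z z = 0%R.
  by rewrite /Defs.edist big1 ?sqrtr0// => i _; rewrite subrr expr0n.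
have posz y : p y <> z -> (0 < eudist z (p y) / e)%R.
  move=> pyz; rewrite divr_gt0// lt_neqAle eudist_ge0 andbT eq_sym.
  by apply/eqP => /eudist_eq0 zpy; apply: pyz.
transitivity (((e ^+ n.+1)^-1)%:E *
    \int[m]_y (phi_pos phi (eudist z (p y) / e) * h y)%:E).
  congr (_ * _); apply: ae_eq_integral => //.
  - have -> : (fun y => (phi (eudist z (p y) / e) * h y)%:E) =
        (fun y => ((phi_pos phi (eudist z (p y) / e) +
           phi 0 * \1_(p @^-1` [set z]) y) * h y)%:E).
      apply/funext => y; congr ((_ * _)%:E); rewrite indicE.
      have [pyz|pyz] := pselect (p y = z).
        by rewrite mem_set// pyz Ez mul0r /phi_pos ltxx add0r mulr1.
      by rewrite memNset// mulr0 addr0 phi_posE//; exact: posz.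
    apply/measurable_EFinP; apply: measurable_funM => //; apply: measurable_funD.
      exact: measurableT_comp mphi mdist.
    by apply: measurable_funM => //; exact: measurable_indic.
  - exists (p @^-1` [set z]); split => // y /= pyz; apply: contrapT => h'.
    by apply: pyz => _; rewrite phi_posE//; exact: posz.
rewrite -ge0_integralZl_EFin//.
- by apply: eq_integral => y _; rewrite -EFinM mulrA.
- by move=> y _; rewrite lee_fin mulr_ge0.
- by rewrite invr_ge0 exprn_ge0// ltW.
Qed.

End averages.

Section lebesgue_as_point_map.
Context {R : realType}.
Local Notation T := (measurableTypeR R).
Local Open Scope ereal_scope.

Lemma measurable_Rn_tuple n :
  measurable_fun [set: Rn R n] (fun y : Rn R n => (y : n.-tuple T)).
Proof. by move=> _ A mA; rewrite setTI; exact: (measurable_Rn mA). Qed.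

Lemma lebesgue_tuple1 n (z : n.+1.-tuple T) :
  @lebesgue R n.+1 ((fun y : Rn R n.+1 => (y : n.+1.-tuple T)) @^-1` [set z]) = 0.
Proof.
have := lebesgueE (measurable_tuple1 z).
by rewrite measure_tuple1.
Qed.

End lebesgue_as_point_map.

(** The level lambda / A1 is chosen so that the bound of [cz_weak] is lambda;
    each average m_j is then at most lambda off the exceptional set. *)
Lemma random_dilation_weak_type (R : realType) (n : nat) 
  (phi : R -> R)
  (phi_ge0 : forall r : R, 0 < r -> 0 <= phi r)
  (phi_derivable : forall r : R, 0 < r -> derivable phi r 1)
  (phi_int : (\int[@lebesgue_measure R]_(r in `]0%R, +oo[)
                (r ^+ n * phi r)%:E < +oo)%E)
  (B : R)
  (phi_drv : forall r : R, 0 < r -> `|derive1 phi r| <= B / r ^+ n.+2)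
  (d : measure_display) (Omega : measurableType d) (P : probability Omega R)
  (eps : nat -> Omega -> R)
  (eps_gt0 : forall j : nat, (1 <= j)%N -> forall w : Omega, 0 < eps j w) :
  weak_type_1_1 (@maximal_op d Omega R P n.+1 phi eps).
Proof.
pose A := profile_cst n phi B.
have A0 : 0 <= A by exact: profile_cst_ge0.
have A'0 : 0 <= 2 ^+ n.+2 * A by apply: mulr_ge0 => //; exact: exprn_ge0.
pose A1 := 2 ^+ n.+2 * A + 2.
have A10 : 0 < A1 by rewrite ltr_wpDl.
pose C := 1 + dirac_cst n (2 ^+ n.+2 * A).
have C0 : 0 < C by rewrite ltr_pwDl// dirac_cst_ge0.
exists (C * A1); first exact: mulr_gt0.
move=> lambda f lambda0 fint.
have [mf flty] := integrableP _ _ _ fint.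
pose h (y : Rn R n.+1) : R := `|f y|.
have mh : measurable_fun [set: Rn R n.+1] h.
  by apply: measurableT_comp => //; exact/measurable_EFinP.
have h0 y : 0 <= h y by exact: normr_ge0.
have NE : ('N[@lebesgue R n.+1]_1[EFin \o f] = \int[@lebesgue R n.+1]_y (h y)%:E)%E.
  by rewrite Lnorm1; apply: eq_integral.
have Nfin : (\int[@lebesgue R n.+1]_y (h y)%:E \is a fin_num)%E.
  rewrite ge0_fin_numE; last by apply: integral_ge0 => y _; rewrite lee_fin.
  by move: flty; apply: le_lt_trans; rewrite le_eqVlt; apply/orP; left; apply/eqP; apply: eq_integral.
pose F := fine (\int[@lebesgue R n.+1]_y (h y)%:E).
have FE : (\int[@lebesgue R n.+1]_y (h y)%:E = F%:E)%E by rewrite fineK.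
have F0 : 0 <= F by apply: fine_ge0; apply: integral_ge0 => y _; rewrite lee_fin.
have lam0 : 0 < lambda / A1 by rewrite divr_gt0.
have FE' : (\int[@lebesgue R n.+1]_y (h y)%:E <= F%:E)%E by rewrite FE.
have [G [mG muG GA]] := cz_weak (@measurable_Rn_tuple R n.+1) A0 lam0 F0 mh h0 FE'.
apply: (@le_trans _ _ (@lebesgue R n.+1 G)).
  apply: le_lebesgue => x /= Mx; apply: contrapT => Gx.
  move: Mx; apply/negP; rewrite -leNgt; apply: ge_ereal_sup => _ [j /= j0 <-].
  have avg w : ((((eps j w ^+ n.+1)^-1)%:E *
      \int[@lebesgue R n.+1]_z (phi (eudist x z / eps j w) * h z)%:E) =
      \int[@lebesgue R n.+1]_z (dilate n phi (eps j w) (eudist x z) * h z)%:E)%E.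
    have mphi := measurable_phi_pos phi_derivable.
    have phi0 := phi_pos_ge0 phi_ge0.
    exact: (integral_dilate (@measurable_Rn_tuple R n.+1) (lebesgue_tuple1 x)
      mphi mh phi0 h0 (eps_gt0 _ j0 w)).
  rewrite /mean_op; apply: probability_integral_le; first exact: ltW.
  - move=> w; rewrite avg; apply: integral_ge0 => y _.
    by rewrite lee_fin mulr_ge0// /dilate mulr_ge0 ?phi_pos_ge0// invr_ge0 exprn_ge0// ltW ?eps_gt0.
  - move=> w; rewrite avg.
    have ck := cz_kernel_dilate phi_ge0 phi_derivable phi_int phi_drv (eps_gt0 _ j0 w).
    have k0 : dilate n phi (eps j w) 0 = 0 by rewrite /dilate mul0r /phi_pos ltxx mulr0.
    have := GA _ _ ck k0 Gx.
    by rewrite -/A1 mulrCA mulfV ?mulr1// gt_eqF.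
rewrite (lebesgueE mG); apply: (le_trans muG).
rewrite NE FE -EFinM lee_fin -/C le_eqVlt; apply/orP; left; apply/eqP.
by field; rewrite !gt_eqF.
Qed.

Theorem theorem3p2 (R : realType) (n : nat) (n_ge1 : (1 <= n)%N)
  (phi : R -> R)
  (phi_ge0 : forall r : R, 0 < r -> 0 <= phi r)
  (phi_derivable : forall r : R, 0 < r -> derivable phi r 1)
  (phi_C1 : forall r : R, 0 < r -> {for r, continuous (derive1 phi)})
  (phi_int : (\int[@lebesgue_measure R]_(r in `]0%R, +oo[)
                (r ^+ n.-1 * phi r)%:E < +oo)%E)
  (B : R)
  (phi_drv : forall r : R, 0 < r -> `|derive1 phi r| <= B / r ^+ n.+1)
  (d : measure_display) (Omega : measurableType d) (P : probability Omega R)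
  (eps : nat -> {RV P >-> R})
  (eps_gt0 : forall j : nat, (1 <= j)%N -> forall w : Omega, 0 < eps j w)
  (nu : nat -> probability R R)
  (eps_law : forall j : nat, (1 <= j)%N -> forall A : set R, measurable A ->
     distribution P (eps j) A = nu j A)
  (nu_self_similar : self_similar nu) :
  weak_type_1_1 (@maximal_op d Omega R P n phi (fun j => eps j)).
Proof.
case: n n_ge1 phi_int phi_drv => // n _ phi_int phi_drv.
exact: (@random_dilation_weak_type R n phi phi_ge0 phi_derivable phi_int B
  phi_drv d Omega P (fun j => eps j) eps_gt0).
Qed.
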